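(* Let $A$ be a properly infinite $C^*$-algebra with real rank zero. Then the monoid $\mathrm{V}(A)$ has weak divisibility of order units; that is, for every order unit $v\in\mathrm{V}(A)$ there exist $a,b\in\mathrm{V}(A)$ such that $v=2a+3b$.
   Context: Projections $p,q$ are Murray-von Neumann equivalent, $p\sim q$, if $p=vv^*$, $q=v^*v$ for a partial isometry $v$; $p\precsim q$ means $p\sim p'\le q$ for some projection $p'$. A non-zero projection $p$ is properly infinite if $p\oplus p\precsim p$. A (unital) $C^*$-algebra is properly infinite if its unit is a properly infinite projection. A $C^*$-algebra has real rank zero if the invertible self-adjoint elements are dense in the self-adjoint elements. $\mathrm{V}(A)$ is the abelian monoid of Murray-von Neumann equivalence classes $[p]$ of projections in $M_\infty(A)=\bigcup_n M_n(A)$, with $[p]+[q]=[p\oplus q]$. It carries the algebraic ordering: $x\le y$ if $x+z=y$ for some $z\in\mathrm{V}(A)$. An order unit in a monoid $M$ is a non-zero element $u$ such that for every $x\in M$ there is $n\in\mathbb{N}$ with $x\le nu$. *)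

(* Defs.v *)
From HB Require Import structures.
From mathcomp Require Import all_boot all_order all_algebra.
From mathcomp Require Import generic_quotient complex.
From mathcomp Require Import boolp reals.
Set Implicit Arguments.
Unset Strict Implicit.
Unset Printing Implicit Defensive.
Import Order.TTheory GRing.Theory Num.Theory.
Local Open Scope ring_scope.
Local Open Scope quotient_scope.

(* Unital complex C*-algebras.  The norm is an explicit field because
   Hierarchy-Builder cannot join algType with completeNormedModType (the only
   declared common extension of rings and normed Z-modules is numDomainType).
   The ring structures of MathComp that carry an algebra require 1 != 0, so the
   zero algebra is excluded; it is not properly infinite anyway. *)
HB.mixin Record isCStarAlgebra (R : realType) A of GRing.Algebra R[i] A := {
  star : A -> A;
  cnorm : A -> R;
  starK : involutive star;
  starD : {morph star : x y / x + y};
  starZ : forall (c : R[i]) (x : A), star (c *: x) = conjc c *: star x;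
  starM : forall x y : A, star (x * y) = star y * star x;
  cnorm_eq0 : forall x : A, cnorm x = 0 -> x = 0;
  ler_cnormD : forall x y : A, cnorm (x + y) <= cnorm x + cnorm y;
  cnormZ : forall (c : R[i]) (x : A),
    cnorm (c *: x) = ComplexField.Normc.normc c * cnorm x;
  ler_cnormM : forall x y : A, cnorm (x * y) <= cnorm x * cnorm y;
  cnorm_star : forall x : A, cnorm (star x * x) = cnorm x ^+ 2;
  cnorm_complete : forall u : nat -> A,
    (forall e : R, 0 < e -> exists N, forall m n,
        (N <= m)%N -> (N <= n)%N -> cnorm (u m - u n) < e) ->
    exists l : A, forall e : R, 0 < e -> exists N, forall n,
        (N <= n)%N -> cnorm (u n - l) < e }.

#[short(type="cstarAlgType")]
HB.structure Definition CStarAlgebra (R : realType) :=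
  {A of isCStarAlgebra R A & GRing.Algebra R[i] A}.

Section RealRankZero.
Variables (R : realType) (A : cstarAlgType R).

Definition selfadjoint (a : A) : Prop := star a = a.

Definition invertible (a : A) : Prop := exists b : A, a * b = 1 /\ b * a = 1.

Definition real_rank_zero : Prop :=
  forall a : A, selfadjoint a -> forall e : R, 0 < e ->
  exists b : A, [/\ selfadjoint b, invertible b & cnorm (a - b) < e].

End RealRankZero.

Section Projections.
Variables (R : realType) (A : cstarAlgType R).

Definition adjmx m n (M : 'M[A]_(m, n)) : 'M[A]_(n, m) := map_mx star M^T.

Definition is_proj n (p : 'M[A]_n) : bool :=
  (p *m p == p) && (adjmx p == p).

Definition partial_isometry m n (v : 'M[A]_(m, n)) : Prop :=
  v *m adjmx v *m v = v.

(* For n <= N, the inclusion of M_n(A) in M_N(A) as the upper left corner. *)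
Definition corner N n (M : 'M[A]_n) : 'M[A]_N :=
  pid_mx n *m M *m pid_mx n.

(* The partial isometry lives in M_infty(A) = \bigcup_N M_N(A). *)
Definition mvn_equiv n m (p : 'M[A]_n) (q : 'M[A]_m) : Prop :=
  exists N (v : 'M[A]_N), [/\ (n <= N)%N, (m <= N)%N, partial_isometry v,
    corner N p = v *m adjmx v & corner N q = adjmx v *m v].

Definition dsum n m (p : 'M[A]_n) (q : 'M[A]_m) : 'M[A]_(n + m) :=
  block_mx p 0 0 q.

(* The usual order of projections, p <= q iff p = q p. *)
Definition proj_le n (p q : 'M[A]_n) : Prop := q *m p = p.

(* A projection below q in M_infty(A) lies in the same corner as q. *)
Definition mvn_sub n m (p : 'M[A]_n) (q : 'M[A]_m) : Prop :=
  exists p' : 'M[A]_m, [/\ is_proj p', mvn_equiv p p' & proj_le p' q].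

Definition properly_infinite_proj n (p : 'M[A]_n) : Prop :=
  [/\ is_proj p, p != 0 & mvn_sub (dsum p p) p].

(* A is identified with M_1(A). *)
Definition properly_infinite : Prop :=
  properly_infinite_proj (1%:M : 'M[A]_1).

Lemma star0 : star 0 = 0 :> A.
Proof. by apply: (addrI (star 0)); rewrite -starD !addr0. Qed.

Lemma star1 : star 1 = 1 :> A.
Proof. by have := starM (star 1 : A) 1; rewrite mulr1 starK mulr1 => <-. Qed.

Lemma star_sum I (r : seq I) (P : pred I) (F : I -> A) :
  star (\sum_(i <- r | P i) F i) = \sum_(i <- r | P i) star (F i).
Proof. by apply: big_morph; [exact: starD | exact: star0]. Qed.

Lemma adjmxK m n : cancel (@adjmx m n) (@adjmx n m).
Proof. by move=> M; apply/matrixP => i j; rewrite !mxE starK. Qed.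

Lemma adjmxM m n k (M : 'M[A]_(m, n)) (N : 'M[A]_(n, k)) :
  adjmx (M *m N) = adjmx N *m adjmx M.
Proof.
apply/matrixP => i j; rewrite !mxE star_sum; apply: eq_bigr => l _.
by rewrite !mxE starM.
Qed.

Lemma adjmx0 m n : adjmx (0 : 'M[A]_(m, n)) = 0.
Proof. by apply/matrixP => i j; rewrite !mxE star0. Qed.

Lemma adjmx_pid m n k : adjmx (pid_mx k : 'M[A]_(m, n)) = pid_mx k.
Proof.
rewrite /adjmx tr_pid_mx; apply/matrixP => i j; rewrite !mxE.
by case: (_ && _); [exact: star1 | exact: star0].
Qed.

Lemma adjmx_block m1 m2 n1 n2 (a : 'M[A]_(m1, n1)) (b : 'M[A]_(m1, n2))
    (c : 'M[A]_(m2, n1)) (d : 'M[A]_(m2, n2)) :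
  adjmx (block_mx a b c d) =
  block_mx (adjmx a) (adjmx c) (adjmx b) (adjmx d).
Proof. by rewrite /adjmx tr_block_mx map_block_mx. Qed.

Lemma is_projP n (p : 'M[A]_n) :
  reflect (p *m p = p /\ adjmx p = p) (is_proj p).
Proof. by apply: (iffP andP) => -[/eqP-> /eqP->]. Qed.

Lemma pid_corner N n : (n <= N)%N ->
  (pid_mx n : 'M[A]_(n, N)) *m (pid_mx n : 'M[A]_(N, n)) = 1%:M.
Proof. by move=> nN; rewrite mul_pid_mx minnn (minn_idPr nN) pid_mx_1. Qed.

Lemma compressP N n m (J : 'M[A]_(N, n)) (K : 'M[A]_(N, m)) (v : 'M[A]_N)
    (p : 'M[A]_n) (q : 'M[A]_m) :
  adjmx J *m J = 1%:M -> adjmx K *m K = 1%:M -> partial_isometry v ->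
  J *m p *m adjmx J = v *m adjmx v -> K *m q *m adjmx K = adjmx v *m v ->
  let w := adjmx J *m v *m K in
  [/\ partial_isometry w, p = w *m adjmx w & q = adjmx w *m w].
Proof.
move=> JJ KK vP pv qv w.
have Jv : J *m (adjmx J *m v) = v.
  have e : v = J *m (p *m adjmx J *m v) by rewrite !mulmxA pv vP.
  by rewrite [in LHS]e (mulmxA (adjmx J) J) JJ mul1mx -e.
have vK : v *m K *m adjmx K = v.
  have e : v = v *m K *m q *m adjmx K by rewrite -[LHS]vP -mulmxA -qv !mulmxA.
  by rewrite [in LHS]e -(mulmxA _ (adjmx K) K) KK mulmx1 -e.
have Kv : K *m (adjmx K *m adjmx v) = adjmx v.
  by rewrite -adjmxM -[X in X *m _]adjmxK -adjmxM vK.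
have ws : adjmx w = adjmx K *m adjmx v *m J by rewrite !adjmxM adjmxK mulmxA.
have wp : w *m adjmx w = p.
  rewrite ws /w mulmxA -(mulmxA _ K) Kv -(mulmxA (adjmx J) v).
  rewrite -pv !mulmxA JJ mul1mx.
  by rewrite -mulmxA JJ mulmx1.
have wq : adjmx w *m w = q.
  rewrite ws /w mulmxA -(mulmxA _ J) Jv -(mulmxA (adjmx K) (adjmx v)).
  rewrite -qv !mulmxA KK mul1mx.
  by rewrite -mulmxA KK mulmx1.
split=> //; rewrite /partial_isometry wp /w !mulmxA; congr (_ *m _).
have -> : p *m adjmx J = adjmx J *m (J *m p *m adjmx J).
  by rewrite !mulmxA JJ mul1mx.
by rewrite pv -mulmxA vP.
Qed.

(* Equivalent form with a rectangular partial isometry. *)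
Lemma mvn_equivP n m (p : 'M[A]_n) (q : 'M[A]_m) :
  mvn_equiv p q <-> exists w : 'M[A]_(n, m),
    [/\ partial_isometry w, p = w *m adjmx w & q = adjmx w *m w].
Proof.
have adjJ N k : adjmx (pid_mx k : 'M[A]_(N, k)) = pid_mx k.
  exact: adjmx_pid.
have JJ N k : (k <= N)%N ->
    adjmx (pid_mx k : 'M[A]_(N, k)) *m (pid_mx k : 'M[A]_(N, k)) = 1%:M.
  by move=> kN; rewrite adjJ pid_corner.
split=> [[N [v [nN mN vP pv qv]]]|[w [wP pw qw]]].
  rewrite /corner -!adjJ in pv qv.
  by eexists; exact: (compressP (JJ _ _ nN) (JJ _ _ mN) vP pv qv).
have nN := leq_addr m n; have mN := leq_addl n m.
pose J : 'M[A]_(n + m, n) := pid_mx n; pose K : 'M[A]_(n + m, m) := pid_mx m.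
pose v := J *m w *m adjmx K; exists (n + m)%N, v.
have vs : adjmx v = K *m adjmx w *m adjmx J by rewrite !adjmxM adjmxK mulmxA.
have vp : v *m adjmx v = J *m p *m adjmx J.
  rewrite vs /v mulmxA (mulmxA _ K) -(mulmxA _ (adjmx K)) (JJ _ _ mN) mulmx1.
  by rewrite -(mulmxA J) -pw.
have vq : adjmx v *m v = K *m q *m adjmx K.
  rewrite vs /v mulmxA (mulmxA _ J) -(mulmxA _ (adjmx J)) (JJ _ _ nN) mulmx1.
  by rewrite -(mulmxA K) -qw.
split=> //; first last.
- by rewrite vq /corner adjJ.
- by rewrite vp /corner adjJ.
rewrite /partial_isometry vp /v mulmxA (mulmxA _ J) -(mulmxA _ (adjmx J)).
by rewrite (JJ _ _ nN) mulmx1 -(mulmxA J) pw wP.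
Qed.

Lemma mvn_refl n (p : 'M[A]_n) : is_proj p -> mvn_equiv p p.
Proof.
case/is_projP=> pp ps; apply/mvn_equivP; exists p.
by rewrite /partial_isometry ps !pp.
Qed.

Lemma mvn_sym n m (p : 'M[A]_n) (q : 'M[A]_m) :
  mvn_equiv p q -> mvn_equiv q p.
Proof.
case/mvn_equivP=> w [wP pw qw]; apply/mvn_equivP; exists (adjmx w).
rewrite /partial_isometry adjmxK; split=> //.
by rewrite -[in RHS]wP !adjmxM adjmxK mulmxA.
Qed.

Lemma mvn_trans n m k (p : 'M[A]_n) (q : 'M[A]_m) (r : 'M[A]_k) :
  mvn_equiv p q -> mvn_equiv q r -> mvn_equiv p r.
Proof.
case/mvn_equivP=> v [vP pv qv] /mvn_equivP[w [wP qw rw]].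
apply/mvn_equivP; exists (v *m w).
have e : v *m w *m (adjmx w *m adjmx v) = v *m adjmx v.
  rewrite mulmxA -(mulmxA v) -qw qv mulmxA.
  by rewrite vP.
rewrite /partial_isometry adjmxM e; split=> //.
  by rewrite mulmxA vP.
have -> : adjmx w *m adjmx v *m (v *m w) = adjmx w *m (q *m w).
  by rewrite qv !mulmxA.
by rewrite qw wP.
Qed.

Lemma is_proj_dsum n m (p : 'M[A]_n) (q : 'M[A]_m) :
  is_proj p -> is_proj q -> is_proj (dsum p q).
Proof.
move=> /is_projP[pp ps] /is_projP[qq qs]; apply/is_projP; split.
  by rewrite /dsum mulmx_block !mul0mx !mulmx0 !addr0 add0r pp qq.
by rewrite /dsum adjmx_block !adjmx0 ps qs.
Qed.

Lemma mvn_dsum n1 m1 n2 m2 (p1 : 'M[A]_n1) (q1 : 'M[A]_m1)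
    (p2 : 'M[A]_n2) (q2 : 'M[A]_m2) :
  mvn_equiv p1 q1 -> mvn_equiv p2 q2 ->
  mvn_equiv (dsum p1 p2) (dsum q1 q2).
Proof.
case/mvn_equivP=> v [vP pv qv] /mvn_equivP[w [wP pw qw]].
apply/mvn_equivP; exists (block_mx v 0 0 w).
rewrite /partial_isometry adjmx_block !adjmx0.
rewrite !mulmx_block !(mul0mx, mulmx0, addr0, add0r) vP wP.
by rewrite /dsum -pv -qv -pw -qw.
Qed.

Lemma mvn_dsumC n m (p : 'M[A]_n) (q : 'M[A]_m) :
  is_proj p -> is_proj q -> mvn_equiv (dsum p q) (dsum q p).
Proof.
move=> /is_projP[pp ps] /is_projP[qq qs]; apply/mvn_equivP.
exists (block_mx 0 p q 0).
rewrite /partial_isometry adjmx_block !adjmx0 ps qs.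
by rewrite !mulmx_block !(mul0mx, mulmx0, addr0, add0r) !pp !qq.
Qed.

Lemma mvn_castmx n n' (e : (n = n') * (n = n')) (p : 'M[A]_n) :
  is_proj p -> mvn_equiv (castmx e p) p.
Proof.
case: e => e1 e2; rewrite (eq_irrelevance e2 e1); case: n' / e1 {e2}.
by rewrite castmx_id; exact: mvn_refl.
Qed.

Lemma mvn_dsumA n m k (p : 'M[A]_n) (q : 'M[A]_m) (r : 'M[A]_k) :
  is_proj p -> is_proj q -> is_proj r ->
  mvn_equiv (dsum p (dsum q r)) (dsum (dsum p q) r).
Proof.
move=> pP qP rP; have P := is_proj_dsum (is_proj_dsum pP qP) rP.
have := @block_mxA _ n m k n m k p 0 0 0 q 0 0 0 r.
rewrite /= !(row_mx0, col_mx0) -/(dsum q r) -/(dsum p q) -!/(dsum _ _) => ->.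
exact: mvn_castmx.
Qed.

Lemma dsum0 n (p : 'M[A]_n) : dsum (0 : 'M[A]_0) p = p.
Proof.
apply/matrixP => i j.
have -> : i = rshift 0 i by exact: val_inj.
have -> : j = rshift 0 j by exact: val_inj.
rewrite block_mxEdr; congr (p _ _); exact: val_inj.
Qed.

Lemma is_proj0 : is_proj (0 : 'M[A]_0).
Proof. by apply/is_projP; rewrite mul0mx adjmx0. Qed.

Definition proj_infty := {n : nat & {p : 'M[A]_n | is_proj p}}.

Definition ProjInfty n (p : 'M[A]_n) (pP : is_proj p) : proj_infty :=
  existT _ n (exist _ p pP).

Definition psize (x : proj_infty) : nat := tag x.
Definition pmx (x : proj_infty) : 'M[A]_(psize x) := val (tagged x).

Lemma pmxP (x : proj_infty) : is_proj (pmx x).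
Proof. exact: valP (tagged x). Qed.

Definition mvn_rel (x y : proj_infty) : bool := `[< mvn_equiv (pmx x) (pmx y) >].

Lemma mvn_rel_refl : reflexive mvn_rel.
Proof. by move=> x; apply/asboolP; exact/mvn_refl/pmxP. Qed.

Lemma mvn_rel_sym : symmetric mvn_rel.
Proof. by move=> x y; apply/asboolP/asboolP; exact: mvn_sym. Qed.

Lemma mvn_rel_trans : transitive mvn_rel.
Proof.
by move=> y x z /asboolP xy /asboolP yz; apply/asboolP; exact: mvn_trans yz.
Qed.

Canonical mvn_rel_equiv :=
  EquivRel mvn_rel mvn_rel_refl mvn_rel_sym mvn_rel_trans.

Definition V := {eq_quot mvn_rel}.

HB.instance Definition _ : EqQuotient _ mvn_rel V := EqQuotient.on V.
HB.instance Definition _ := Choice.on V.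

Definition dsum_infty (x y : proj_infty) : proj_infty :=
  ProjInfty (is_proj_dsum (pmxP x) (pmxP y)).

Definition addV (x y : V) : V := \pi_V (dsum_infty (repr x) (repr y)).

Definition zeroV : V := \pi_V (ProjInfty is_proj0).

Lemma mvn_repr x : mvn_equiv (pmx (repr (\pi_V x))) (pmx x).
Proof. by have /eqmodP/asboolP : repr (\pi_V x) = x %[mod V] by rewrite reprK. Qed.

Lemma addV_pi x y : addV (\pi_V x) (\pi_V y) = \pi_V (dsum_infty x y).
Proof. by apply/eqmodP/asboolP/mvn_dsum; exact: mvn_repr. Qed.

Lemma addVA : associative addV.
Proof.
elim/quotW=> x; elim/quotW=> y; elim/quotW=> z.
rewrite (addV_pi y z) (addV_pi x y) (addV_pi x (dsum_infty y z)).
rewrite (addV_pi (dsum_infty x y) z).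
by apply/eqmodP/asboolP; exact: mvn_dsumA (pmxP x) (pmxP y) (pmxP z).
Qed.

Lemma addVC : commutative addV.
Proof.
elim/quotW=> x; elim/quotW=> y; rewrite (addV_pi x y) (addV_pi y x).
by apply/eqmodP/asboolP; exact: mvn_dsumC (pmxP x) (pmxP y).
Qed.

Lemma add0V : left_id zeroV addV.
Proof.
elim/quotW=> x; rewrite addV_pi; apply/eqmodP/asboolP.
by rewrite /pmx /= dsum0; exact/mvn_refl/pmxP.
Qed.

HB.instance Definition _ := GRing.isNmodule.Build V addVA addVC add0V.

End Projections.

Section OrderUnits.
Variable M : nmodType.

Definition alg_le (x y : M) : Prop := exists z, x + z = y.

Definition order_unit (u : M) : Prop :=
  u != 0 /\ forall x : M, exists n : nat, alg_le x (u *+ n).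

Definition weak_divisibility_order_units : Prop :=
  forall v : M, order_unit v -> exists a b : M, v = a *+ 2 + b *+ 3.

End OrderUnits.

(* Main.v *)
(** The monoid [V A] has the refinement property: for projections with
  [p + p' = q + q'] real rank zero yields the exchange property for the
  selfadjoint element [p q p] of the corner [p A p] (through a spectral
  projection of an invertible selfadjoint element close to [p q p - 1/2]), and
  hence projections [r <= q], [r' <= q'] with [p ~ r + r'] and
  [p' ~ (q - r) + (q' - r')].

  If [v] is an order unit then [u <= n v] for the class [u] of the unit, and
  every class is below [u] as [A] is properly infinite, so [(n + 1) v <= n v].
  Refining this inequality and using the pigeonhole principle, [v] is a sum of
  elements [x] with [2 x <= v]; such elements can be merged into a single [c]
  with [2 c <= v <= K c].  Writing [v = 2 c + d] with [d <= K c] and refining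
  again, [v] is a sum of multiples [k x] with [k >= 2]. *)

Require Import Defs.
From Stdlib Require Ncring Ncring_tac.
From mathcomp Require Import all_boot all_order all_algebra.
From mathcomp Require Import generic_quotient complex.
From mathcomp Require Import boolp classical_sets reals ring lra.
Set Implicit Arguments.
Unset Strict Implicit.
Unset Printing Implicit Defensive.
Import Order.TTheory GRing.Theory Num.Theory.
Local Open Scope ring_scope.
Local Open Scope quotient_scope.

(** * Refinement monoids *)

Definition refinement (M : nmodType) := forall a b c d : M, a + b = c + d ->
  exists x y z w, [/\ a = x + y, b = z + w, c = x + z & d = y + w].

Section RefinementMonoid.
Variable M : nmodType.
Hypothesis refM : refinement M.
Implicit Types a b c d u v x y z : M.

Lemma alg_le_refl x : alg_le x x. Proof. by exists 0; rewrite addr0. Qed.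

Lemma alg_le_trans y x z : alg_le x y -> alg_le y z -> alg_le x z.
Proof. by case=> u <- [w <-]; exists (u + w); rewrite addrA. Qed.

Lemma alg_leD x y u v : alg_le x y -> alg_le u v -> alg_le (x + u) (y + v).
Proof. by case=> a <- [b <-]; exists (a + b); rewrite addrACA. Qed.

Lemma alg_leDr x y : alg_le x (x + y). Proof. by exists y. Qed.

Lemma alg_leDl x y : alg_le x (y + x). Proof. by exists y; rewrite addrC. Qed.

Lemma alg_leMn x y n : alg_le x y -> alg_le (x *+ n) (y *+ n).
Proof. by case=> u <-; exists (u *+ n); rewrite mulrnDl. Qed.

Lemma riesz x a b : alg_le x (a + b) ->
  exists x1 x2, [/\ x = x1 + x2, alg_le x1 a & alg_le x2 b].
Proof.
case=> z /refM[x1 [x2 [z1 [z2 [-> _ -> ->]]]]].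
by exists x1, x2; split=> //; exact: alg_leDr.
Qed.

Definition two_three v := exists a b, v = a *+ 2 + b *+ 3.

Lemma two_threeD u v : two_three u -> two_three v -> two_three (u + v).
Proof.
case=> a [b ->] [c [d ->]]; exists (a + c), (b + d).
by rewrite !mulrnDl addrACA.
Qed.

Lemma two_three_mulrn x n : (2 <= n)%N -> two_three (x *+ n).
Proof.
elim/ltn_ind: n => -[|[|[|[|n]]]] // IH _.
- by exists x, 0; rewrite mul0rn addr0.
- by exists 0, x; rewrite mul0rn add0r.
have -> : n.+4 = (2 + n.+2)%N by [].
rewrite mulrnDr; apply: two_threeD; last exact: IH.
by exists x, 0; rewrite mul0rn addr0.
Qed.

(** Induction on [K]. Split [d = d1 + d2] with [d1 <= c] and [d2 <= K c], write [c = d1 + e], and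
    split [d2] along [K d1 + K e]. The sum regroups into two expressions of the same shape, over
    [d1] with [n + 1] and over [e] with [n], both with bound [K]. *)
Lemma two_three_mulrnD K n c d : (2 <= n)%N -> alg_le d (c *+ K) ->
  two_three (c *+ n + d).
Proof.
elim: K n c d => [|K IH] n c d n2.
  case=> z dz; apply: two_threeD; first exact: two_three_mulrn.
  (* d is invertible here, with inverse z *)
  exists z, d; rewrite mulr0n in dz.
  by rewrite (mulrSr d 2) addrA -mulrnDl [z + d]addrC dz mul0rn add0r.
rewrite mulrS => /riesz[d1 [d2 [-> [e ce] d2K]]].
move: d2K; rewrite -ce mulrnDl => /riesz[d3 [d4 [-> d3K d4K]]].
have -> : (d1 + e) *+ n + (d1 + (d3 + d4)) = (d1 *+ n.+1 + d3) + (e *+ n + d4).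
  rewrite mulrnDl mulrSr -!addrA; congr (_ + _); rewrite addrCA.
  by congr (_ + _); rewrite addrCA.
by apply: two_threeD; apply: IH => //; exact: leqW.
Qed.

(** * Elements bounded by multiples of some [c] with [2 c <= v] *)

Variable v : M.

Definition halvable y :=
  exists c K, alg_le (c *+ 2) v /\ alg_le y (c *+ K).

Lemma halvable2 y : alg_le (y *+ 2) v -> halvable y.
Proof. by move=> yv; exists y, 1; split=> //; exact: alg_le_refl. Qed.

(** Refining [v = 2 x + z] against two copies of [y] gives [y = a1 + q1 = a2 + q2] with
    [a1 + a2 <= 2 x] and [q1 + q2 <= z]. The common part [t] of [q1] and [q2] has [2 t <= z], so
    [c = x + t] fits twice into [v]; the rest of [y] is [a1] plus a part of [a2], hence below
    [4 x]. *)
Lemma common_half x y : alg_le (x *+ 2) v -> alg_le (y *+ 2) v ->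
  exists c, [/\ alg_le (c *+ 2) v, alg_le x c & alg_le y (c *+ 4)].
Proof.
case=> z xz [w]; rewrite -{1}xz [y *+ 2]mulr2n -addrA.
move=> /esym/refM[a1 [b [q1 [d [xab zqd ya1 ybd]]]]].
have [a2 [q2 [b' [d' [ya2 _ bE dE]]]]] := refM ybd.
have [s [t' [t'' [t [a1E q1E a2E q2E]]]]] : exists s t' t'' t,
    [/\ a1 = s + t', q1 = t'' + t, a2 = s + t'' & q2 = t' + t].
  by apply: refM; rewrite -ya1.
have le1 : alg_le a1 (x *+ 2) by rewrite xab; exact: alg_leDr.
have le2 : alg_le a2 (x *+ 2).
  by rewrite xab bE addrCA; exact: alg_leDr.
exists (x + t); split; last 2 first.
- exact: alg_leDr.
- rewrite ya1 q1E addrA mulrnDl; apply: alg_leD; last first.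
    by rewrite mulrS; exact: alg_leDr.
  have -> : x *+ 4 = x *+ 2 + x *+ 2 by rewrite -mulrnDr.
  apply: alg_leD => //; apply: alg_le_trans le2.
  by rewrite a2E; exact: alg_leDl.
rewrite mulrnDl -xz; apply: alg_leD; first exact: alg_le_refl.
rewrite zqd dE mulr2n addrA; apply: alg_le_trans (alg_leDr _ _).
by apply: alg_leD; rewrite ?q1E ?q2E; exact: alg_leDl.
Qed.

Lemma halvableD x y : halvable x -> halvable y -> halvable (x + y).
Proof.
case=> c [K [cv xc]] [d [L [dv yd]]].
have [e [ev ce de]] := common_half cv dv.
exists e, (K + 4 * L)%N; split=> //; rewrite mulrnDr mulrnA; apply: alg_leD.
  by apply: alg_le_trans xc _; exact: alg_leMn.
by apply: alg_le_trans yd _; exact: alg_leMn.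
Qed.

(* [u0] collects the parts of [y] lying in none of the [A]-parts of the copies
   of [y] met so far, [u1] those lying in exactly one, [g] the other ones. *)
Lemma halvable_copies m k y u0 u1 g A A0 B B0 :
    y = u0 + u1 + g -> alg_le (A0 + A) v -> alg_le u1 A0 -> halvable g ->
    alg_le (u0 *+ k.+1 + u1 *+ k) B0 -> y *+ m = A + B ->
  exists u g', [/\ y = u + g', halvable g' & alg_le (u *+ (k + m)) (B0 + B)].
Proof.
elim: m k u0 u1 g A A0 B B0 => [|m IH] k u0 u1 g A A0 B B0 yE Av u1A gh kB.
  move=> _; exists (u0 + u1), g; split=> //; rewrite addn0.
  apply: alg_le_trans (alg_leDr _ B); apply: alg_le_trans kB.
  by rewrite mulrnDl mulrSr addrAC; exact: alg_leDr.
rewrite mulrS => /refM[a [b [A' [B' [yab yAB AE BE]]]]].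
have [u [w [ga [gb [uE gE aE bE]]]]] : exists u w ga gb,
    [/\ u0 + u1 = u + w, g = ga + gb, a = u + ga & b = w + gb].
  by apply: refM; rewrite -yE.
have [u0a [u0b [u1a [u1b [u0E u1E uE' wE]]]]] := refM uE.
have yE' : y = u0b + (u0a + u1b) + (g + u1a).
  by rewrite yE u0E u1E [LHS](AC (2*2*1) (2*(1*4)*(5*3))).
have Av' : alg_le (A0 + a + A') v by rewrite -addrA -AE.
have u1' : alg_le (u0a + u1b) (A0 + a).
  rewrite addrC; apply: alg_leD; last first.
    by rewrite aE uE'; rewrite -addrA; exact: alg_leDr.
  by apply: alg_le_trans u1A; rewrite u1E; exact: alg_leDl.
(* [u1a] lies in the [A]-part of an earlier copy and in that of the new one, so twice it is below
   [A0 + a <= v]. *)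
have gh' : halvable (g + u1a).
  apply: halvableD => //; apply: halvable2; apply: alg_le_trans Av.
  rewrite mulr2n AE; apply: alg_leD.
    by apply: alg_le_trans u1A; rewrite u1E; exact: alg_leDr.
  apply: alg_le_trans (alg_leDr _ _); rewrite aE uE'.
  by rewrite addrAC; exact: alg_leDl.
have kB' : alg_le (u0b *+ k.+2 + (u0a + u1b) *+ k.+1) (B0 + b).
  apply: (@alg_le_trans (u0 *+ k.+1 + u1 *+ k + (u0b + u1b))); last first.
    apply: alg_leD => //; rewrite bE wE; exact: alg_leDr.
  exists (u1a *+ k); rewrite u0E u1E !mulrnDl !mulrSr.
  by rewrite [LHS](AC (3*(2*2)*1) ((4*5)*(1*2)*(8*6)*(3*7))).
have [u' [g' [E1 E2 E3]]] := IH _ _ _ _ _ _ _ _ yE' Av' u1' gh' kB' yAB.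
by exists u', g'; rewrite addnS -addSn BE addrA.
Qed.

(** Induction on [k]: split the [k + 2] copies of [y] into [A <= v] and [B <= k v]. The part of [y]
    met at least twice in [A] is halvable; the rest [u] misses [A] in at least [k + 1] copies, so
    [(k + 1) u <= B]. *)
Lemma halvable_pigeonhole k y : alg_le (y *+ k.+1) (v *+ k) -> halvable y.
Proof.
elim: k y => [|k IH] y.
  by move=> yv; exists 0, 0%N; rewrite mul0rn; split=> //; exists v; rewrite add0r.
move=> ykv.
have [A [B [yAB Av Bkv]]] : exists A B, [/\ y *+ k.+2 = A + B, alg_le A v
    & alg_le B (v *+ k)] by apply: riesz; rewrite -mulrS.
move: yAB; rewrite mulrS => /refM[a [b [A' [B' [yab yAB AE BE]]]]].
(* The first copy starts the count: its [A]-part [a] has been met once, its [B]-part [b] not at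
   all. *)
have [u [g [yE gh uB]]] : exists u g, [/\ y = u + g, halvable g
    & alg_le (u *+ (0 + k.+1)) (b + B')].
  apply: (@halvable_copies _ _ y b a 0 A' a) => //.
  - by rewrite addr0 addrC.
  - by rewrite -AE.
  - exact: alg_le_refl.
  - by exists 0, 0%N; rewrite !mul0rn; split; [exists v; rewrite add0r|exact: alg_le_refl].
  - by rewrite mulr0n addr0; exact: alg_le_refl.
rewrite yE; apply: halvableD => //; apply: IH.
by apply: alg_le_trans Bkv; rewrite BE.
Qed.

Lemma refinement_two_three n : alg_le (v *+ n.+1) (v *+ n) -> two_three v.
Proof.
move/halvable_pigeonhole=> [c [K [[d cd] vK]]].
rewrite -cd; apply: (@two_three_mulrnD K) => //; apply: alg_le_trans vK.
by rewrite -cd; exact: alg_leDl.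
Qed.

End RefinementMonoid.

(** * Identities in noncommutative rings *)

Section NonCommutativeRing.
Variable A : pzRingType.

#[export] Instance nc_ring_ops :
  @Ncring.Ring_ops A 0 1 +%R *%R (fun x y => x - y) -%R eq := {}.
#[export] Instance nc_ring : Ncring.Ring (Ro := nc_ring_ops).
Proof.
split; try exact _; rewrite /Algebra_syntax.equality /Ncring.eq_notation
  /Algebra_syntax.addition /Ncring.add_notation
  /Algebra_syntax.multiplication /Ncring.mul_notation
  /Algebra_syntax.zero /Ncring.zero_notation
  /Algebra_syntax.one /Ncring.one_notation /=.
- exact: add0r.
- exact: addrC.
- exact: addrA.
- exact: mul1r.
- exact: mulr1.
- exact: mulrA.
- by move=> *; rewrite mulrDl.
- by move=> *; rewrite mulrDr.
- by [].
- exact: subrr.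
Qed.

End NonCommutativeRing.

Ltac nc_ring := Ncring_tac.non_commutative_ring.

(** * Square roots and positivity in C*-algebras *)

Section CStar.
Variables (R : realType) (A : cstarAlgType R).
Implicit Types (a b c e f g h k p q r s v x y z : A) (t T : R).

Local Notation "t *r x" := ((t%:C)%C *: x) (at level 40).
Local Notation "t %:r" := ((t%:C)%C%:A) (at level 2, format "t %:r").

Lemma starN x : star (- x) = - star x.
Proof. by apply/eqP; rewrite -addr_eq0 -starD addNr star0. Qed.

Lemma starB x y : star (x - y) = star x - star y.
Proof. by rewrite starD starN. Qed.

Lemma starZr t x : star (t *r x) = t *r star x.
Proof. by rewrite starZ conjc_real. Qed.

Lemma cnormZr t x : cnorm (t *r x) = `|t| * cnorm x.
Proof. by rewrite cnormZ /= expr0n addr0 sqrtr_sqr. Qed.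

Lemma cnorm0 : cnorm (0 : A) = 0.
Proof. by rewrite -(scale0r (0 : A)) cnormZ ComplexField.Normc.normc0 mul0r. Qed.

Lemma cnormN x : cnorm (- x) = cnorm x.
Proof.
have -> : - x = (-1) *r x by rewrite rmorphN1 scaleN1r.
by rewrite cnormZr normrN1 mul1r.
Qed.

Lemma cnorm_ge0 x : 0 <= cnorm x.
Proof.
have := ler_cnormD x (- x); rewrite subrr cnorm0 cnormN -mulr2n.
by rewrite pmulrn_lge0.
Qed.

Lemma ler_cnormB x y : cnorm (x - y) <= cnorm x + cnorm y.
Proof. by rewrite -(cnormN y) ler_cnormD. Qed.

Lemma cdistC x y : cnorm (x - y) = cnorm (y - x).
Proof. by rewrite -cnormN opprB. Qed.

Lemma cnorm_le0 x : cnorm x <= 0 -> x = 0.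
Proof.
by move=> x0; apply: cnorm_eq0; apply/eqP; rewrite eq_le x0 cnorm_ge0.
Qed.

Lemma cnormS x : cnorm (star x) = cnorm x.
Proof.
suff le y : cnorm y <= cnorm (star y).
  by apply/eqP; rewrite eq_le le -[in X in _ <= X](starK x) le.
have [->|] := eqVneq (cnorm y) 0; first exact: cnorm_ge0.
move=> y0; have yp : 0 < cnorm y by rewrite lt_neqAle eq_sym y0 cnorm_ge0.
by rewrite -(ler_pM2r yp) -expr2 -cnorm_star ler_cnormM.
Qed.

Lemma cnorm1 : cnorm (1 : A) = 1.
Proof.
have := cnorm_star (1 : A); rewrite star1 mulr1 => n1.
have n0 : cnorm (1 : A) != 0 by apply: contra_neq (oner_neq0 A) => /cnorm_eq0.
by apply: (mulfI n0); rewrite mulr1 -expr2.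
Qed.

Lemma cnorm_sqr h : star h = h -> cnorm (h * h) = cnorm h ^+ 2.
Proof. by move=> hs; rewrite -cnorm_star hs. Qed.

Lemma star_mul_eq0 x : star x * x = 0 -> x = 0.
Proof.
move=> x0; apply: cnorm_eq0; apply/eqP.
by rewrite -sqrf_eq0 -cnorm_star x0 cnorm0.
Qed.

(** * Limits in norm *)

Definition ccvg (u : nat -> A) (l : A) := forall e : R, 0 < e ->
  exists N, forall n, (N <= n)%N -> cnorm (u n - l) < e.

(** [Y] is nondecreasing and bounded; once it is within [e / 2] of its supremum, [u] moves by less
    than [e / 2], so [u] is Cauchy. *)
Lemma ccvg_dominated (u : nat -> A) (Y : nat -> R) (B : R) :
  (forall n, cnorm (u n.+1 - u n) <= Y n.+1 - Y n) -> (forall n, Y n <= B) ->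
  exists l, ccvg u l.
Proof.
move=> uY YB.
have dist n m : cnorm (u (n + m)%N - u n) <= Y (n + m)%N - Y n.
  elim: m => [|m IH]; first by rewrite addn0 !subrr cnorm0.
  rewrite addnS -(subrK (u (n + m)%N) (u _.+1)) -addrA.
  apply: le_trans (ler_cnormD _ _) _.
  by have := uY (n + m)%N; lra.
have supY : has_sup (range Y).
  by split; [exists (Y 0%N), 0%N | exists B => _ [n _ <-]].
apply: cnorm_complete => e e0.
have [_ [N _ <-] supN] := sup_adherent (divr_gt0 e0 (ltr0n R 2)) supY.
have near n : (N <= n)%N -> cnorm (u n - u N) < e / 2.
  move=> Nn; rewrite -(subnKC Nn); apply: le_lt_trans (dist _ _) _.
  suff : Y (N + (n - N))%N <= sup (range Y) by lra.
  by apply: ub_le_sup; [exact: supY.2 | eexists].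
exists N => m n Nm Nn; rewrite -(subrK (u N) (u m)) -addrA.
apply: le_lt_trans (ler_cnormD _ _) _.
by have := near m Nm; have := near n Nn; rewrite (cdistC (u N)); lra.
Qed.

(** Passes identities to the limit: [x] is the defect of the identity at [l], and two consecutive
    errors suffice for recursively defined sequences. *)
Lemma ccvg_eq0 (u : nat -> A) l x (C : R) : 0 < C -> ccvg u l ->
  (forall n, cnorm x <= C * (cnorm (u n - l) + cnorm (u n.+1 - l))) -> x = 0.
Proof.
move=> C0 ul xC; apply: cnorm_le0; rewrite leNgt; apply/negP => x0.
have e0 : 0 < cnorm x / C / 2 by rewrite !divr_gt0.
have [N Nu] := ul _ e0.
have xCN : cnorm x / C <= cnorm (u N - l) + cnorm (u N.+1 - l).
  by rewrite ler_pdivrMr // mulrC.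
by have := Nu N (leqnn N); have := Nu N.+1 (leqnSn N); lra.
Qed.

Lemma ccvg_cnorm_le (u : nat -> A) l (B : R) :
  ccvg u l -> (forall n, cnorm (u n) <= B) -> cnorm l <= B.
Proof.
move=> ul uB; rewrite leNgt; apply/negP; rewrite -subr_gt0 => Bl.
have [N /(_ N (leqnn N))] := ul _ Bl.
have := ler_cnormB (u N) (u N - l); rewrite subKr; have := uB N; lra.
Qed.

Lemma ccvg_comm (u : nat -> A) l c : ccvg u l -> (forall n, GRing.comm c (u n)) ->
  GRing.comm c l.
Proof.
move=> ul cu; apply/eqP; rewrite -subr_eq0; apply/eqP.
apply: (@ccvg_eq0 _ _ _ (2 * cnorm c + 1) _ ul) => [|n].
  by have := cnorm_ge0 c; lra.
have -> : c * l - l * c = (u n - l) * c - c * (u n - l).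
  by rewrite mulrBr (cu n); nc_ring.
apply: le_trans (ler_cnormB _ _) _.
have := ler_cnormM (u n - l) c; have := ler_cnormM c (u n - l).
have := cnorm_ge0 (u n - l); have := cnorm_ge0 (u n.+1 - l).
have := cnorm_ge0 c; nra.
Qed.

Lemma comm_subr_sqr x y : GRing.comm x y -> x * x - y * y = (x - y) * (x + y).
Proof. by move=> xy; rewrite mulrDr !mulrBl xy; nc_ring. Qed.

(** * Square root of [1 - k] by iteration *)

Fixpoint sqrt_iter k n : A :=
  if n is m.+1 then 2^-1 *r (k + sqrt_iter k m * sqrt_iter k m) else 0.

Fixpoint sqrt_iterR n : R :=
  if n is m.+1 then 2^-1 * (1 + sqrt_iterR m * sqrt_iterR m) else 0.

Lemma sqrt_iterR_bound n : 0 <= sqrt_iterR n <= 1.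
Proof. by elim: n => [|n] /=; [rewrite lexx ler01 | nra]. Qed.

Section SquareRoot.
Variable k : A.
Hypothesis k1 : cnorm k <= 1.
Local Notation u := (sqrt_iter k).

Lemma sqrt_iter_comm c n : GRing.comm c k -> GRing.comm c (u n).
Proof.
move=> ck; elim: n => [|n IH] /=; first exact: commr0.
rewrite /GRing.comm -scalerAl -scalerAr; congr (_ *: _).
by apply: commrD => //; apply: commrM.
Qed.

Lemma sqrt_iter_comm_iter n m : GRing.comm (u n) (u m).
Proof.
by apply: sqrt_iter_comm; apply: commr_sym; apply: sqrt_iter_comm.
Qed.

Lemma cnorm_sqrt_iter n : cnorm (u n) <= sqrt_iterR n.
Proof.
elim: n => [|n IH] /=; first by rewrite cnorm0.
rewrite cnormZr ger0_norm ?invr_ge0 // ler_pM2l ?invr_gt0 //.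
apply: le_trans (ler_cnormD _ _) _; apply: lerD => //.
by apply: le_trans (ler_cnormM _ _) _; apply: ler_pM => //; exact: cnorm_ge0.
Qed.

(** As iterates commute, each increment is half the previous increment times the sum of its two
    iterates; the real sequence satisfies the same recursion, and the factors are compared one by
    one. *)
Lemma sqrt_iter_dominated n :
  cnorm (u n.+1 - u n) <= sqrt_iterR n.+1 - sqrt_iterR n.
Proof.
elim: n => [|n IH]; first by rewrite !subr0; exact: (cnorm_sqrt_iter 1).
have -> : u n.+2 - u n.+1 = 2^-1 *r ((u n.+1 - u n) * (u n.+1 + u n)).
  rewrite -comm_subr_sqr; last exact: sqrt_iter_comm_iter.
  by rewrite /= -scalerBr opprD addrACA subrr add0r.
have -> : sqrt_iterR n.+2 - sqrt_iterR n.+1 =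
    2^-1 * ((sqrt_iterR n.+1 - sqrt_iterR n) * (sqrt_iterR n.+1 + sqrt_iterR n)).
  have E m : sqrt_iterR m.+1 = 2^-1 * (1 + sqrt_iterR m * sqrt_iterR m) by [].
  by have := E n.+1; have := E n; lra.
rewrite cnormZr ger0_norm ?invr_ge0 // ler_pM2l ?invr_gt0 //.
apply: le_trans (ler_cnormM _ _) _; apply: ler_pM => //; try exact: cnorm_ge0.
by apply: le_trans (ler_cnormD _ _) _; apply: lerD; exact: cnorm_sqrt_iter.
Qed.

(* The iteration [y |-> (k + y^2) / 2] starting at [0] has polynomials in [k]
   with nonnegative coefficients as increments, so it is dominated by the same
   iteration for [k = 1] in [R], which stays in [[0, 1]]. *)
Lemma sqrt_one_sub : exists y, [/\ (1 - y) * (1 - y) = 1 - k, cnorm y <= 1,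
  (star k = k -> star y = y) & forall c, GRing.comm c k -> GRing.comm c y].
Proof.
have R1 n : sqrt_iterR n <= 1 by case/andP: (sqrt_iterR_bound n).
have [y uy] := ccvg_dominated sqrt_iter_dominated R1.
have u1 n : cnorm (u n) <= 1 := le_trans (cnorm_sqrt_iter n) (R1 n).
have y1 := ccvg_cnorm_le uy u1.
have ylim n : 0 <= cnorm (u n - y) := cnorm_ge0 _.
have ucomm c : GRing.comm c k -> GRing.comm c y.
  by move=> ck; apply: ccvg_comm uy _ => n; apply: sqrt_iter_comm.
exists y; split=> //; last first.
  move=> ks.
  have us n : star (u n) = u n.
    by elim: n => [|n IH] /=; rewrite ?star0 // starZr starD starM ks IH.
  apply/eqP; rewrite -subr_eq0; apply/eqP; apply: (@ccvg_eq0 _ _ _ 2 _ uy) => // n.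
  have -> : star y - y = (u n - y) - star (u n - y).
    by rewrite starB us; nc_ring.
  apply: le_trans (ler_cnormB _ _) _; rewrite cnormS.
  by have := ylim n; have := ylim n.+1; lra.
(* The limit solves the fixed point equation [2 y = k + y^2], which is [(1 - y)^2 = 1 - k]. *)
have yE : (y + y) - (k + y * y) = 0.
  apply: (@ccvg_eq0 _ _ _ 2 _ uy) => // n.
  have -> : (y + y) - (k + y * y)
    = (u n * u n - y * y) - ((u n.+1 - y) + (u n.+1 - y)).
    have -> : (u n.+1 - y) + (u n.+1 - y) = k + u n * u n - (y + y).
      rewrite addrACA -opprD -mulr2n -scaler_nat scalerA.
      rewrite -[2%:R](rmorph_nat (real_complex R)) -rmorphM mulfV ?pnatr_eq0 //.
      by rewrite scale1r.
    by nc_ring.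
  apply: le_trans (ler_cnormB _ _) _.
  have -> : u n * u n - y * y = (u n - y) * u n + y * (u n - y) by nc_ring.
  have := ler_cnormD ((u n - y) * u n) (y * (u n - y)).
  have := ler_cnormM (u n - y) (u n); have := ler_cnormM y (u n - y).
  have := ler_cnormD (u n.+1 - y) (u n.+1 - y).
  have := ylim n; have := u1 n; nra.
have -> : (1 - y) * (1 - y) = 1 - k - ((y + y) - (k + y * y)) by nc_ring.
by rewrite yE subr0.
Qed.

End SquareRoot.

(** * Neumann series *)

Section Neumann.
Variable h : A.

Fixpoint neumann n : A := if n is m.+1 then 1 + h * neumann m else 0.

Lemma neumann_comm n : GRing.comm h (neumann n).
Proof.
elim: n => [|n IH] /=; first exact: commr0.
by apply: commrD; [exact: commr1 | exact: commrM].
Qed.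

Lemma invertible_one_sub : cnorm h < 1 -> invertible (1 - h).
Proof.
move=> h1; pose Y := fix Y n : R := if n is m.+1 then 1 + cnorm h * Y m else 0.
have dom n : cnorm (neumann n.+1 - neumann n) <= Y n.+1 - Y n.
  elim: n => [|n IH]; first by rewrite /= !(mulr0, addr0, subr0) cnorm1.
  have -> : neumann n.+2 - neumann n.+1 = h * (neumann n.+1 - neumann n).
    have E m : neumann m.+1 = 1 + h * neumann m by [].
    by rewrite mulrBr (E n.+1) [X in _ - X]E opprD addrACA subrr add0r.
  have -> : Y n.+2 - Y n.+1 = cnorm h * (Y n.+1 - Y n).
    have E m : Y m.+1 = 1 + cnorm h * Y m by [].
    by rewrite mulrBr (E n.+1) [X in _ - X]E opprD addrACA subrr add0r.
  apply: le_trans (ler_cnormM _ _) _.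
  by apply: ler_wpM2l => //; exact: cnorm_ge0.
have bound n : Y n <= (1 - cnorm h)^-1.
  have p : 0 < 1 - cnorm h by lra.
  elim: n => [|n IH] /=; first by rewrite invr_ge0 ltW.
  rewrite -(ler_pM2r p) mulVf ?gt_eqF //.
  by rewrite -(ler_pM2r p) mulVf ?gt_eqF // in IH; have := cnorm_ge0 h; nra.
have [s us] := ccvg_dominated dom bound.
have hs : GRing.comm h s := ccvg_comm us neumann_comm.
have sE : (1 - h) * s - 1 = 0.
  apply: (@ccvg_eq0 _ _ _ 2 _ us) => // n.
  have -> : (1 - h) * s - 1 = h * (neumann n - s) - (neumann n.+1 - s).
    by rewrite /=; nc_ring.
  apply: le_trans (ler_cnormB _ _) _.
  have := ler_cnormM h (neumann n - s); have := cnorm_ge0 (neumann n - s).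
  have := cnorm_ge0 (neumann n.+1 - s); nra.
move/eqP: sE; rewrite subr_eq0 => /eqP sE; exists s; split=> //.
by rewrite -[RHS]sE mulrBl mulrBr hs mul1r mulr1.
Qed.

End Neumann.

(** * Positivity as closeness to a scalar *)

Lemma star_scalar t : star (t%:r : A) = t%:r.
Proof. by rewrite starZr star1. Qed.

Lemma scale_scalar t T : t *r (T%:r : A) = (t * T)%:r.
Proof. by rewrite scalerA -rmorphM. Qed.

Lemma invertible_near_scalar t a : cnorm (t%:r - a) < t -> invertible a.
Proof.
move=> ta; have t0 : 0 < t := le_lt_trans (cnorm_ge0 _) ta.
have [|b [ab ba]] := @invertible_one_sub (t^-1 *r (t%:r - a)).
  rewrite cnormZr gtr0_norm ?invr_gt0 //.
  by rewrite mulrC ltr_pdivrMr // mul1r.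
have E : 1 - t^-1 *r (t%:r - a) = t^-1 *r a.
  by rewrite scalerBr scale_scalar mulVf ?gt_eqF // scale1r subKr.
rewrite E in ab ba; exists (t^-1 *r b).
by rewrite -scalerAr scalerAl ab -scalerAl scalerAr ba.
Qed.

(** Replaces an appeal to the spectrum: a self-adjoint square root [s] of [1 - h^2] is the imaginary
    part of a unitary, hence has norm at most 1. *)
Lemma cnorm_one_sub_sqr h : star h = h -> cnorm h <= 1 ->
  cnorm (1 - h * h) <= 1.
Proof.
move=> hs h1.
have hh1 : cnorm (h * h) <= 1 by rewrite cnorm_sqr // expr_le1 // cnorm_ge0.
have [y [yE y1 ys yc]] := sqrt_one_sub hh1.
have {}ys : star y = y by apply: ys; rewrite starM hs.
rewrite -yE; set s := 1 - y.
have ss : star s = s by rewrite /s starB star1 ys.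
have hS : GRing.comm h s.
  by apply: commrB; [exact: commr1 | apply: yc; apply: commrM].
(* [u = h + i sqrt (1 - h^2)] is unitary *)
pose u := h + 'i%C *: s.
have us : star u = h - 'i%C *: s.
  by rewrite /u starD hs starZ ss -scaleNr; congr (_ + _ *: _); simpc.
have u1 : cnorm u <= 1.
  rewrite -(@ler_pXn2r _ 2) ?nnegrE ?cnorm_ge0 ?ler01 // -cnorm_star us expr1n.
  have -> : (h - 'i%C *: s) * u = h * h + s * s.
    rewrite mulrBl (mulrDr h) (mulrDr ('i%C *: s)) -!scalerAl -!scalerAr -hS scalerA.
    have -> : 'i%C * 'i%C = -1 :> R[i] by rewrite -expr2 sqr_i.
    by rewrite scaleN1r; nc_ring.
  have -> : h * h + s * s = 1 by rewrite yE; nc_ring.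
  by rewrite cnorm1.
have s1 : cnorm s <= 1.
  have : cnorm (u - star u) = 2 * cnorm s.
    rewrite us /u opprB addrC addrA addrNK -scalerDl cnormZ; congr (_ * _).
    by rewrite /= addr0 expr0n add0r sqrtr_sqr ger0_norm // addr_ge0.
  by have := ler_cnormB u (star u); rewrite cnormS; lra.
by rewrite cnorm_sqr // expr_le1 // cnorm_ge0.
Qed.

(** For self-adjoint [a], the bound [cnorm (T%:r - a) <= T] encodes positivity of [a]. Squares
    satisfy it, and adding two such bounds gives one for the sum. *)
Lemma cnorm_scalar_sub_sqr T h : star h = h -> 0 < T -> cnorm h ^+ 2 <= T ->
  cnorm (T%:r - h * h) <= T.
Proof.
move=> hs T0 hT; pose t := Num.sqrt T; have t0 : 0 < t by rewrite sqrtr_gt0.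
have TE : T = t * t by rewrite -expr2 sqr_sqrtr // ltW.
have E : T%:r - h * h = T *r (1 - (t^-1 *r h) * (t^-1 *r h)).
  rewrite -scalerAl -scalerAr scalerA scalerBr scalerA -!rmorphM.
  by rewrite TE -invfM mulfV ?scale1r // mulf_neq0 // gt_eqF.
rewrite E cnormZr gtr0_norm //.
rewrite -[X in _ <= X]mulr1 ler_pM2l //; apply: cnorm_one_sub_sqr.
  by rewrite starZr hs.
rewrite cnormZr gtr0_norm ?invr_gt0 // mulrC ler_pdivrMr // mul1r.
rewrite -(@ler_pXn2r _ 2) ?nnegrE ?cnorm_ge0 ?(ltW t0) //.
by rewrite [t ^+ 2]expr2 -TE.
Qed.

(** Rescaling [a] to [1 - k] with [k = 1 - a / T] reduces to [sqrt_one_sub]. The norm bound says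
    that the root is again positive, so roots can be iterated; the commutation clause stands in for
    functional calculus. *)
Lemma positive_sqrt T a : star a = a -> 0 < T -> cnorm (T%:r - a) <= T ->
  exists s, [/\ star s = s, s * s = a,
    cnorm ((Num.sqrt T)%:r - s) <= Num.sqrt T
    & forall c, GRing.comm c a -> GRing.comm c s].
Proof.
move=> as_ T0 aT; set t := Num.sqrt T; have t0 : 0 < t by rewrite sqrtr_gt0.
have TE : T = t * t by rewrite -expr2 sqr_sqrtr // ltW.
pose k := 1 - T^-1 *r a.
have kE : k = T^-1 *r (T%:r - a).
  by rewrite scalerBr scale_scalar mulVf ?gt_eqF // scale1r.
have [|y [yE y1 ys yc]] := @sqrt_one_sub k.
  rewrite kE cnormZr gtr0_norm ?invr_gt0 //.
  by rewrite mulrC ler_pdivrMr // mul1r.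
exists (t *r (1 - y)); split.
- rewrite starZr starB star1 ys //.
  by rewrite /k starB star1 starZr as_.
- rewrite -scalerAl -scalerAr scalerA -rmorphM -TE yE subKr.
  by rewrite scalerA -rmorphM mulfV ?gt_eqF // scale1r.
- by rewrite -scalerBr subKr cnormZr gtr0_norm // ler_piMr // ltW.
move=> c ca; rewrite /GRing.comm -scalerAl -scalerAr; congr (_ *: _).
apply: commrB; [exact: commr1 | apply: yc; apply: commrB; first exact: commr1].
by rewrite /GRing.comm -scalerAl -scalerAr ca.
Qed.

Lemma absolute_value b : star b = b -> exists c T, [/\ star c = c, c * c = b * b,
  0 < T, cnorm (T%:r - c) <= T & forall d, GRing.comm d b -> GRing.comm d c].
Proof.
move=> bs; pose T := cnorm b ^+ 2 + 1.
have T0 : 0 < T by rewrite ltr_wpDl // sqr_ge0.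
have [||c [cs cb cT cc]] := @positive_sqrt T (b * b) _ T0 _.
- by rewrite starM bs.
- by apply: cnorm_scalar_sub_sqr => //; rewrite lerDl.
exists c, (Num.sqrt T); split=> //; first by rewrite sqrtr_gt0.
by move=> d db; apply: cc; apply: commrM.
Qed.

Lemma sqrD_sqr h k : star h = h -> star k = k ->
  exists2 s, star s = s & s * s = h * h + k * k.
Proof.
move=> hs ks; pose T x := cnorm x ^+ 2 + 1.
have T0 x : 0 < T x by rewrite ltr_wpDl // sqr_ge0.
have [|||s [ss sE _ _]] := @positive_sqrt (T h + T k) (h * h + k * k).
- by rewrite starD !starM hs ks.
- exact: addr_gt0.
- have -> : (T h + T k)%:r - (h * h + k * k) =
      ((T h)%:r - h * h) + ((T k)%:r - k * k).
    by rewrite rmorphD scalerDl opprD addrACA.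
  apply: le_trans (ler_cnormD _ _) _.
  by apply: lerD; apply: cnorm_scalar_sub_sqr; rewrite // /T lerDl.
by exists s.
Qed.

(** The positive cone contains no line: [h^2] and [- h^2 = s^2] are both squares, so [T + h^2] and
    [T - h^2] both have norm at most [T]. *)
Lemma sqrD_eq0 h s : star h = h -> star s = s -> h * h + s * s = 0 -> h = 0.
Proof.
move=> hs ss hs0; apply: cnorm_eq0; apply/eqP/negPn/negP => h0.
pose T := cnorm h ^+ 2; have T0 : 0 < T by rewrite lt_neqAle eq_sym sqrf_eq0 h0 sqr_ge0.
have sE : s * s = - (h * h) by apply/eqP; rewrite -addr_eq0 addrC hs0.
have sT : cnorm s ^+ 2 = T by rewrite -cnorm_sqr // sE cnormN cnorm_sqr.
have hT := cnorm_scalar_sub_sqr hs T0 (lexx _).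
have := @cnorm_scalar_sub_sqr T s ss T0; rewrite sT lexx sE opprK => /(_ isT) sT'.
(* [4 T h^2 = (T + h^2)^2 - (T - h^2)^2] has norm at most [2 T^2] *)
have E : (T%:r + h * h) * (T%:r + h * h) - (T%:r - h * h) * (T%:r - h * h)
    = (4 * T) *r (h * h).
  have -> : (T%:r + h * h) * (T%:r + h * h) - (T%:r - h * h) * (T%:r - h * h)
    = T%:r * (h * h) + T%:r * (h * h) + (h * h * T%:r + h * h * T%:r) by nc_ring.
  rewrite -!scalerAl -!scalerAr mul1r mulr1 -!scalerDl -!rmorphD.
  by congr (_%:C%C *: _); ring.
have := ler_cnormB ((T%:r + h * h) * (T%:r + h * h)) ((T%:r - h * h) * (T%:r - h * h)).
rewrite E cnormZr cnorm_sqr // -/T ger0_norm; last by rewrite mulr_ge0 // ltW.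
have := ler_cnormM (T%:r + h * h) (T%:r + h * h).
have := ler_cnormM (T%:r - h * h) (T%:r - h * h).
have := cnorm_ge0 (T%:r - h * h); have := cnorm_ge0 (T%:r + h * h).
nra.
Qed.

(** * Projections and idempotents *)

Definition cproj p := p * p = p /\ star p = p.

Lemma cproj_comm_eq0 p q : cproj p -> cproj q -> p * q = 0 -> q * p = 0.
Proof. by move=> [_ ps] [_ qs] pq0; rewrite -ps -qs -starM pq0 star0. Qed.

Lemma cprojD p q : cproj p -> cproj q -> p * q = 0 -> cproj (p + q).
Proof.
move=> pP qP pq0; have qp0 := cproj_comm_eq0 pP qP pq0.
have [[pp ps] [qq qs]] := (pP, qP); split; last by rewrite starD ps qs.
by rewrite mulrDl !mulrDr pp qq pq0 qp0 addr0 add0r.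
Qed.

Lemma cprojB p q : cproj p -> cproj q -> p * q = q -> cproj (p - q).
Proof.
move=> [pp ps] [qq qs] pq; have qp : q * p = q by rewrite -qs -ps -starM pq.
split; last by rewrite starB ps qs.
by rewrite mulrBl !mulrBr pp pq qp qq subrr subr0.
Qed.

(** The positive cone, presented through self-adjoint square roots. *)
Definition is_sqr a := exists2 s, star s = s & s * s = a.

Lemma is_sqr_intro h : star h = h -> is_sqr (h * h).
Proof. by exists h. Qed.

Lemma is_sqrD a b : is_sqr a -> is_sqr b -> is_sqr (a + b).
Proof.
case=> h hs <- [k ks <-]; have [s ss sE] := sqrD_sqr hs ks.
by exists s.
Qed.

Lemma is_sqrD_eq0 h b : star h = h -> is_sqr b -> h * h + b = 0 -> h = 0.
Proof. by move=> hs [s ss <-]; exact: sqrD_eq0. Qed.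

Lemma sqr_i_scale x : ('i%C *: x) * ('i%C *: x) = - (x * x).
Proof.
by rewrite -scalerAl -scalerAr scalerA ['i%C * _]sqr_i scaleN1r.
Qed.

Lemma star_i_sub z : star ('i%C *: (z - star z)) = 'i%C *: (z - star z).
Proof.
rewrite starZ starB starK -opprB scalerN -scaleNr; congr (_ *: _).
by apply/eqP; rewrite eq_complex /= oppr0 opprK !eqxx.
Qed.

(** The element is the sum of the squares of the self-adjoint elements [z + star z] and
    [i (z - star z)]. *)
Lemma is_sqr_star_sum z :
  is_sqr ((z * star z + star z * z) + (z * star z + star z * z)).
Proof.
have := is_sqrD (is_sqr_intro (_ : star (z + star z) = z + star z))
  (is_sqr_intro (_ : star ('i%C *: (z - star z)) = 'i%C *: (z - star z))).
rewrite sqr_i_scale.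
have -> : (z + star z) * (z + star z) - (z - star z) * (z - star z) =
    (z * star z + star z * z) + (z * star z + star z * z) by nc_ring.
by apply; [rewrite starD starK addrC | exact: star_i_sub].
Qed.

(* If [z^* z = - g^2] with [z g = 2 z] then [c = z z^*] satisfies [c^2 = - 4 c],
   so [z z^* + z^* z], a positive multiple of a sum of squares, is also minus a
   sum of squares. *)
Lemma star_mul_opp_sqr z g : star g = g -> z * g = z + z ->
  star z * z = - (g * g) -> g = 0.
Proof.
move=> gs zg zz; set c := z * star z.
have cs : star c = c by rewrite starM starK.
have cc : c * c = - ((c + c) + (c + c)).
  have -> : c * c = z * (star z * z) * star z by rewrite /c !mulrA.
  by rewrite zz mulrN mulNr mulrA zg mulrDl zg -/c; congr (- _); rewrite !mulrDl.
have gg := is_sqr_intro gs.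
have S := is_sqrD (is_sqr_star_sum z) (is_sqr_star_sum z).
have gg3 := is_sqrD (is_sqrD gg gg) gg.
apply: (is_sqrD_eq0 gs (is_sqrD gg3 (is_sqrD S (is_sqr_intro cs)))).
by rewrite zz cc -/c; nc_ring.
Qed.

(** * Polar decomposition and equivalence of projections *)

(** Polar decomposition [b = e c] with [c] the absolute value and [e] the sign of [b]. From
    [c^2 = b^2] the inverse of [c] is [c b'^2]. *)
Lemma sign_decomposition b : star b = b -> invertible b -> exists c ci e T,
  [/\ [/\ 0 < T, star c = c & cnorm (T%:r - c) <= T],
      [/\ c * ci = 1, ci * c = 1, e * c = b & star e = e],
      [/\ e * e = 1, e = b * ci & b * e = c]
    & forall d, GRing.comm d b -> GRing.comm d c /\ GRing.comm d ci].
Proof.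
move=> bs [b' [bb' b'b]]; have [c [T [cs cb T0 cT comc]]] := absolute_value bs.
have cb' : c * b' = b' * c by apply/commr_sym/comc; rewrite /GRing.comm bb'.
pose ci := c * b' * b'.
have cci : c * ci = 1 by rewrite /ci !mulrA cb -!mulrA (mulrA b b' b') bb' mul1r.
have cic : ci * c = 1 by rewrite -cci /ci -!mulrA -cb' (mulrA b') -cb' -!mulrA.
have comci d : GRing.comm d b -> GRing.comm d ci.
  move=> db; have db' : GRing.comm d b'.
    by rewrite /GRing.comm -[LHS]mul1r -b'b -!mulrA (mulrA b d) -db -mulrA bb' mulr1.
  by rewrite /ci; do 2!apply: commrM => //; apply: comc.
have bci : b * ci = ci * b by apply: comci.
have ics : star ci = ci.
  by rewrite -[LHS]mulr1 -cci mulrA -[in star ci * c]cs -starM cci star1 mul1r.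
clearbody ci; exists c, ci, (b * ci), T; split=> //; first split=> //.
- by rewrite -mulrA cic mulr1.
- by rewrite starM ics bs bci.
- split=> //.
    have -> : b * ci * (b * ci) = b * b * ci * ci.
      by rewrite -!mulrA (mulrA ci) -bci !mulrA.
    by rewrite -cb -(mulrA c) cci mulr1 cci.
  by rewrite mulrA -cb -mulrA cci mulr1.
by move=> d db; split; [exact: comc | exact: comci].
Qed.

(** Once [x] and [y] are cut down to the corners, [B = star x x + (1 - q)] is invertible with
    inverse [C = y (star y) + (1 - q)]. The partial isometry is the polar part [x c^(-1/2)] of [x],
    where [c] is the absolute value of [B]. *)
Lemma mvn_of_algebraic p q x y : cproj p -> cproj q -> x * y = p -> y * x = q ->
  exists v, v * star v = p /\ star v * v = q.
Proof.
move=> [pp ps] [qq qs].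
wlog [px [xq [qy yp]]] : x y / p * x = x /\ x * q = x /\ q * y = y /\ y * p = y.
  move=> W xy yx; apply: (W (p * x * q) (q * y * p)).
  - by rewrite -!mulrA pp qq !mulrA pp qq.
  - rewrite -!mulrA (mulrA q q) qq !mulrA -(mulrA p x q) -yx.
    by rewrite !mulrA -(mulrA _ x y) xy -(mulrA _ x y) xy pp pp pp.
  - rewrite -!mulrA (mulrA p p) pp !mulrA -(mulrA q y p) -xy.
    by rewrite !mulrA -(mulrA _ y x) yx -(mulrA _ y x) yx qq qq qq.
move=> xy yx.
have [B BE] : exists B, B = star x * x + (1 - q) by eexists.
have [C CE] : exists C, C = y * star y + (1 - q) by eexists.
have qx' : q * star x = star x by rewrite -[in LHS]qs -starM xq.
have y'q : star y * q = star y by rewrite -[in LHS]qs -starM qy.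
have x'p : star x * p = star x by rewrite -[in LHS]ps -starM px.
have Bs : star B = B by rewrite BE starD starB star1 qs starM starK.
have Bq : B * q = star x * x.
  by rewrite BE mulrDl mulrBl mul1r qq subrr addr0 -mulrA xq.
have qB : q * B = star x * x.
  by rewrite BE mulrDr mulrBr mulr1 qq subrr addr0 mulrA qx'.
have qC : q * C = y * star y.
  by rewrite CE mulrDr mulrBr mulr1 qq subrr addr0 mulrA qy.
have Cq : C * q = y * star y.
  by rewrite CE mulrDl mulrBl mul1r qq subrr addr0 -mulrA y'q.
have BC : B * C = 1.
  rewrite CE mulrDr mulrBr mulr1 Bq -{1}qy !mulrA Bq.
  rewrite -(mulrA (star x)) xy x'p -starM yx qs BE; nc_ring.
have CB : C * B = 1.
  rewrite BE mulrDr mulrBr mulr1 Cq -{1}qx' !mulrA Cq.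
  by rewrite -(mulrA y) -starM xy ps yp yx CE; nc_ring.
have [||c [ci [e [T [[T0 cs cT] [cci cic ec es] [ee eE Be] com]]]]] := @sign_decomposition B.
- by [].
- by exists C.
have [s [ss sc _ coms]] := positive_sqrt cs T0 cT.
have [qc qci] : q * c = c * q /\ q * ci = ci * q by apply: com; rewrite /GRing.comm qB Bq.
have [Bc Bci] : B * c = c * B /\ B * ci = ci * B by apply: com.
have sci : ci * s = s * ci by apply: coms; rewrite /GRing.comm cic cci.
have qs' : q * s = s * q by apply: coms.
have Bs' : B * s = s * B by apply: coms.
(* [si] is the inverse square root of [c]. *)
have [si siE] : exists si, si = s * ci by eexists.
have sis : star si = si.
  rewrite siE starM ss -sci; congr (_ * _).
  by rewrite -[LHS]mulr1 -cci mulrA -[in star ci * c]cs -starM cci star1 mul1r.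
have sisi : si * si = ci by rewrite siE {1}mulrA -(mulrA s) sci mulrA sc cci mul1r.
have qsi : q * si = si * q by rewrite siE mulrA qs' -!mulrA qci.
have Bsi : B * si = si * B by rewrite siE mulrA Bs' -!mulrA Bci.
have qe : q * e = e * q by rewrite eE mulrA qB -Bq -!mulrA qci.
have esi : e * si = si * e.
  have cisi : ci * si = si * ci by rewrite -sisi mulrA.
  by rewrite eE -mulrA cisi mulrA Bsi -mulrA.
have siBsi : si * B * si = e by rewrite -Bsi -mulrA sisi eE.
(* Shows that the sign of [B] is 1 under [q], without knowing that [star x * x] is positive: for
   [z = x si (1 - e)] and [g = q (1 - e)] one gets [star z * z = - g^2], because
   [e (1 - e)^2 = - (1 - e)^2]. *)
have qe1 : q * (1 - e) = 0.
  apply: (@star_mul_opp_sqr (x * si * (1 - e))).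
  - by rewrite starM starB star1 es qs mulrBr mulrBl mul1r mulr1 qe.
  - rewrite mulrA -(mulrA _ (1 - e) q).
    have -> : (1 - e) * q = q * (1 - e) by rewrite mulrBr mulrBl mul1r mulr1 qe.
    rewrite !mulrA -(mulrA x si q) -qsi mulrA xq -[LHS]mulrA.
    have -> : (1 - e) * (1 - e) = (1 - e) + (1 - e).
      have -> : (1 - e) * (1 - e) = 1 + e * e - e - e by nc_ring.
      by rewrite ee; nc_ring.
    by rewrite mulrDr.
  have e1q : (1 - e) * q = q * (1 - e) by rewrite mulrBr mulrBl mul1r mulr1 qe.
  have -> : star (x * si * (1 - e)) * (x * si * (1 - e)) =
      (1 - e) * (si * B * (q * si)) * (1 - e).
    by rewrite !starM starB star1 es sis !mulrA -(mulrA _ B q) Bq !mulrA.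
  have -> : si * B * (q * si) = e * q by rewrite qsi mulrA siBsi.
  have -> : q * (1 - e) * (q * (1 - e)) = q * ((1 - e) * (1 - e)).
    by rewrite -(mulrA q) (mulrA (1 - e) q) e1q -(mulrA q) (mulrA q q) qq.
  have -> : (1 - e) * (e * q) * (1 - e) = q * ((1 - e) * e * (1 - e)).
    by rewrite -qe (mulrA (1 - e)) e1q -!mulrA.
  have -> : (1 - e) * e * (1 - e) = e - e * e - e * e + e * e * e by nc_ring.
  have -> : (1 - e) * (1 - e) = 1 - e - e + e * e by nc_ring.
  by rewrite ee; nc_ring.
have qeq : q * e = q by apply/eqP; rewrite eq_sym -subr_eq0 -[X in X - _]mulr1 -mulrBr qe1.
have qcB : q * c = q * B by rewrite -ec mulrA qeq.
have qciC : q * ci = q * C.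
  have -> : q * C = ci * (q * c) * C by rewrite qc !mulrA cic mul1r.
  by rewrite qcB -!mulrA BC mulr1 qci.
exists (x * si); rewrite !starM sis; split.
  rewrite mulrA -(mulrA x) sisi -{1}xq -(mulrA x) qciC qC.
  by rewrite mulrA xy -mulrA -starM xy ps pp.
by rewrite -mulrA (mulrA (star x)) -Bq -mulrA qsi !mulrA siBsi -qe.
Qed.

(* Kaplansky's formula for the range projection of an idempotent *)
Lemma range_projection f : f * f = f ->
  exists r, [/\ cproj r, r * f = f & f * r = r].
Proof.
move=> ff; have f'f' : star f * star f = star f by rewrite -starM ff.
have [d dE] : exists d, d = 1 + (f - star f) * (star f - f) by eexists.
have ds : star d = d by rewrite dE starD starM !starB starK star1.
have fd : f * d = f * star f * f.
  rewrite dE; have -> : f * (1 + (f - star f) * (star f - f)) =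
    f + f * f * star f - f * f * f - f * (star f * star f) + f * star f * f by nc_ring.
  by rewrite f'f' !ff; nc_ring.
have df : d * f = f * star f * f.
  rewrite dE; have -> : (1 + (f - star f) * (star f - f)) * f =
    f + f * star f * f - f * (f * f) - star f * star f * f + star f * (f * f) by nc_ring.
  by rewrite f'f' !ff; nc_ring.
(* [d = 1 + h^2] with [h] self-adjoint, so [d] is within [T] of the scalar [T + 1]. *)
have [d' [dd' d'd]] : invertible d.
  pose h := 'i%C *: (f - star f).
  have hs : star h = h := star_i_sub f.
  have hh : h * h = (f - star f) * (star f - f).
    by rewrite sqr_i_scale -mulrN opprB.
  pose T := cnorm h ^+ 2 + 1.
  have T0 : 0 < T by rewrite ltr_wpDl // sqr_ge0.
  apply: (@invertible_near_scalar (T + 1)).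
  have -> : (T + 1)%:r - d = T%:r - h * h.
    by rewrite dE -hh rmorphD scalerDl scale1r; nc_ring.
  apply: le_lt_trans (_ : T < _); last by rewrite ltrDl.
  by apply: cnorm_scalar_sub_sqr => //; rewrite lerDl.
have d's : star d' = d'.
  by rewrite -[LHS]mulr1 -dd' mulrA -{1}ds -starM dd' star1 mul1r.
have fd' : f * d' = d' * f.
  by rewrite -[LHS]mul1r -d'd -!mulrA (mulrA d) df -fd -mulrA dd' mulr1.
have f'd' : star f * d' = d' * star f.
  by rewrite -[in LHS]d's -[in RHS]d's -!starM fd'.
have rf : f * star f * d' * f = f.
  by rewrite -mulrA -fd' mulrA -fd -mulrA dd' mulr1.
exists (f * star f * d'); split=> //; last by rewrite !mulrA ff.
split; last by rewrite !starM starK d's (mulrA d') -fd' -(mulrA f d') -f'd' mulrA.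
by rewrite !mulrA rf.
Qed.

(** * Exchange and refinement for projections *)

(** Real rank zero gives an invertible [b] within [1/4] of [a - 1/2]; [r = (1 + e) / 2] is its
    positive spectral projection. The element [u = a r + (1 - a) (1 - r)] is invertible, and
    conjugating [r] by it gives [f = a r u^-1]. *)
Lemma exchange_selfadjoint a : real_rank_zero A -> star a = a ->
  exists f y z, [/\ f * f = f, f = a * y & 1 - f = (1 - a) * z].
Proof.
move=> rr0 as_; pose hf : A := (2^-1)%:r.
have hf2 : hf + hf = 1.
  rewrite -scalerDl -rmorphD -[RHS]scale1r; congr (_%:C%C *: _).
  by rewrite -[X in X + X]mulr1 -mulrDr mulVf // pnatr_eq0.
have hfC x : hf * x = x * hf by rewrite -scalerAl -scalerAr mul1r mulr1.
have q0 : 0 < 4^-1 :> R by rewrite invr_gt0.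
have ahs : selfadjoint (a - hf) by rewrite /selfadjoint starB as_ star_scalar.
have [b [bs ib ab]] := rr0 _ ahs _ q0.
have [c [ci [e [T [[T0 cs cT] [cci cic ec es] [ee eE be] _]]]]] := sign_decomposition bs ib.
have [r rE] : exists r, r = hf * (1 + e) by eexists.
have r2 : r + r = 1 + e by rewrite rE -mulrDl hf2 mul1r.
have rr : r * r = r.
  have -> : r * r = hf * hf * ((1 + e) * (1 + e)).
    by rewrite rE -(mulrA hf) (mulrA (1 + e)) -hfC !mulrA.
  have -> : (1 + e) * (1 + e) = 1 + e * e + (e + e) by nc_ring.
  rewrite ee rE; have -> : hf * hf * (1 + 1 + (e + e)) = (hf + hf) * hf * (1 + e) by nc_ring.
  by rewrite hf2 mul1r.
have [u uE] : exists u, u = a * r + (1 - a) * (1 - r) by eexists.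
(* [u] differs from [1/2 + c] by less than [1/4] and [c] is positive, so [u] is invertible. *)
have uE' : u = hf + c + (a - hf - b) * e.
  have -> : u = (1 - r) + a * (r + r) - a by rewrite uE; nc_ring.
  have -> : (a - hf - b) * e = a * e - hf * e - c by rewrite !mulrBl be.
  have -> : 1 - r = hf - hf * e by rewrite rE -[X in X - _]hf2; nc_ring.
  by rewrite r2; nc_ring.
have [u' [uu' u'u]] : invertible u.
  apply: (@invertible_near_scalar (T + 2^-1)).
  have -> : (T + 2^-1)%:r - u = (T%:r - c) - (a - hf - b) * e.
    by rewrite uE' rmorphD scalerDl -/hf; nc_ring.
  apply: le_lt_trans (ler_cnormB _ _) _; apply: ler_ltD => //.
  apply: le_lt_trans (ler_cnormM _ _) _.
  have -> : cnorm e = 1.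
    by apply/eqP; rewrite -(@pexpr_eq1 _ _ 2) ?cnorm_ge0 // -cnorm_sqr // ee cnorm1.
  by rewrite mulr1; lra.
have ur : u * r = a * r.
  have -> : u * r = a * (r * r) + (1 - a) * (r - r * r) by rewrite uE; nc_ring.
  by rewrite rr subrr mulr0 addr0.
have ur' : u * (1 - r) = (1 - a) * (1 - r).
  by rewrite mulrBr mulr1 ur uE; nc_ring.
exists (u * r * u'), (r * u'), ((1 - r) * u'); split.
- by rewrite -!mulrA (mulrA u') u'u mul1r (mulrA r) rr.
- by rewrite mulrA ur.
by rewrite mulrA -ur' mulrBr mulr1 mulrBl uu'.
Qed.

(** As [f] lies in [a A], it satisfies [p f = f], so [g = f p] is an idempotent of [p A p].
    Multiplying the witnesses by [g] and [p - g] on the right gives [y g = y] and [z g = 0]. *)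
Lemma exchange_corner p a : real_rank_zero A -> cproj p -> star a = a ->
  p * a = a -> a * p = a -> exists g y z,
  [/\ [/\ g * g = g, p * g = g & g * p = g], a * y = g, (p - a) * z = p - g,
      [/\ p * y = y, y * p = y & y * g = y]
    & [/\ p * z = z, z * p = z & z * g = 0]].
Proof.
move=> rr0 [pp ps] as_ pa ap.
have [f [y [z [ff fy fz]]]] := exchange_selfadjoint rr0 as_.
have pf : p * f = f by rewrite fy mulrA pa.
have gg : f * p * (f * p) = f * p by rewrite mulrA -(mulrA f p) pf ff.
have gp : f * p * p = f * p by rewrite -mulrA pp.
have pg : p * (f * p) = f * p by rewrite mulrA pf.
exists (f * p), (p * y * (f * p)), (p * z * (p - f * p)); split=> //.
- by rewrite !mulrA ap -fy ff.
- have -> : (p - a) * (p * z * (p - f * p)) = p * ((1 - a) * z) * (p - f * p).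
    have -> : (p - a) * (p * z * (p - f * p)) = (p * p - a * p) * (z * (p - f * p)) by nc_ring.
    by rewrite pp ap -{1}pa; nc_ring.
  rewrite -fz (mulrBr p) mulr1 pf.
  by rewrite mulrBl !mulrBr pp pg mulrA ff subrr subr0.
- split; first by rewrite !mulrA pp.
    by rewrite -!mulrA pp.
  by rewrite -(mulrA _ (f * p)) gg.
- split; first by rewrite !mulrA pp.
    by rewrite -mulrA mulrBl pp gp.
  by rewrite -mulrA mulrBl pg gg subrr mulr0.
Qed.

Definition cequiv p q := exists v, v * star v = p /\ star v * v = q.

(** Exchange for [p q p], whose complement in [p] is [p q' p], yields orthogonal idempotents
    [al = q y] and [be = q' z] with [p (al + be) = p]. Their range projections are [r] and [r']. *)
Lemma projection_refinement p p' q q' : real_rank_zero A ->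
  cproj p -> cproj p' -> cproj q -> cproj q' ->
  p * p' = 0 -> q * q' = 0 -> p + p' = q + q' ->
  exists r r', [/\ cproj r /\ cproj r', q * r = r, q' * r' = r', cequiv p (r + r')
    & cequiv p' (q - r + (q' - r'))].
Proof.
move=> rr0 [pp ps] [pp' ps'] [qq qs] [qq' qs'] pp'0 qq'0 E.
have p'p0 : p' * p = 0 by rewrite -ps -ps' -starM pp'0 star0.
have q'q0 : q' * q = 0 by rewrite -qs -qs' -starM qq'0 star0.
have pq' : p * q' = p - p * q.
  have -> : q' = p + p' - q by rewrite E addrAC subrr add0r.
  by rewrite mulrBr mulrDr pp pp'0 addr0.
have [||||g [y [z [[gg pg gp] xy xz [py yp yg] [pz zp zg]]]]] :=
  @exchange_corner p (p * q * p) rr0.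
- by [].
- by rewrite !starM ps qs mulrA.
- by rewrite !mulrA pp.
- by rewrite -mulrA pp.
have [al alE] : exists al, al = q * y by eexists.
have [be beE] : exists be, be = q' * z by eexists.
have pal : p * al = g by rewrite alE -{1}py !mulrA.
have pbe : p * be = p - g.
  by rewrite beE -{1}pz mulrA pq' mulrA -xz [in RHS]mulrBl !mulrBl pp.
have alp : al * p = al by rewrite alE -mulrA yp.
have bep : be * p = be by rewrite beE -mulrA zp.
have alg : al * g = al by rewrite alE -mulrA yg.
have beg : be * g = 0 by rewrite beE -mulrA zg mulr0.
have alal : al * al = al by rewrite -{1}alp -mulrA pal.
have bebe : be * be = be by rewrite -{1}bep -mulrA pbe mulrBr bep beg subr0.
have albe : al * be = 0 by rewrite -{1}alp -mulrA pbe mulrBr alp alg subrr.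
have beal : be * al = 0 by rewrite -{1}bep -mulrA pal.
have qal : q * al = al by rewrite alE mulrA qq.
have q'be : q' * be = be by rewrite beE mulrA qq'.
have [r [[rr rs] ral alr]] := range_projection alal.
have [r' [[rr' rs'] rbe ber]] := range_projection bebe.
have qr : q * r = r by rewrite -alr mulrA qal.
have q'r' : q' * r' = r' by rewrite -ber mulrA q'be.
have rq : r * q = r by rewrite -rs -qs -starM qr.
have r'q' : r' * q' = r' by rewrite -rs' -qs' -starM q'r'.
have rr'0 : r * r' = 0 by rewrite -rq -q'r' mulrA -(mulrA r) qq'0 mulr0 mul0r.
have r'r0 : r' * r = 0 by rewrite -r'q' -qr mulrA -(mulrA r') q'q0 mulr0 mul0r.
(* The idempotent [s] links [p] to [t]: it has the same left ideal as [p] and the same right ideal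
   as [t]. *)
have [s sE] : exists s, s = al + be by eexists.
have [t tE] : exists t : A, t = r + r' by eexists.
have [w wE] : exists w, w = p + p' by eexists.
have rbe0 : r * be = 0.
  by rewrite -rq -q'be mulrA -(mulrA r) qq'0 mulr0 mul0r.
have r'al0 : r' * al = 0.
  by rewrite -r'q' -qal mulrA -(mulrA r') q'q0 mulr0 mul0r.
have alr'0 : al * r' = 0 by rewrite -ber mulrA albe mul0r.
have ber0 : be * r = 0 by rewrite -alr mulrA beal mul0r.
have ts : t * s = s.
  by rewrite tE sE mulrDl !mulrDr ral rbe rbe0 r'al0 addr0 add0r.
have st : s * t = t.
  by rewrite tE sE mulrDl !mulrDr alr ber alr'0 ber0 addr0 add0r.
have ps_ : p * s = p by rewrite sE mulrDr pal pbe addrC subrK.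
have sp : s * p = s by rewrite sE mulrDl alp bep.
have wp : p * w = p by rewrite wE mulrDr pp pp'0 addr0.
have ww : w * w = w by rewrite wE mulrDl !mulrDr pp pp' pp'0 p'p0 addr0 add0r.
have sw : s * w = s by rewrite -sp -mulrA wp.
have qbe0 : q * be = 0 by rewrite -q'be mulrA qq'0 mul0r.
have q'al0 : q' * al = 0 by rewrite -qal mulrA q'q0 mul0r.
have ws : w * s = s.
  by rewrite wE E sE mulrDl !mulrDr qal q'be qbe0 q'al0 addr0 add0r.
have wt : w * t = t by rewrite -st mulrA ws.
have pw : w * p = p by rewrite wE mulrDl pp p'p0 addr0.
have ts_ : star t = t by rewrite tE starD rs rs'.
have tt : t * t = t by rewrite tE mulrDl !mulrDr rr rr' rr'0 r'r0 addr0 add0r.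
have tw : t * w = t.
  have ws_ : star w = w by rewrite wE starD ps ps'.
  by rewrite -ts_ -ws_ -starM wt.
have p'E : p' = w - p by rewrite wE addrAC subrr add0r.
exists r, r'; split=> //; rewrite -?tE.
  apply: (@mvn_of_algebraic p t (p * t) s) => //.
  - by rewrite -mulrA ts.
  - by rewrite mulrA sp st.
have -> : q - r + (q' - r') = w - t by rewrite wE E tE; nc_ring.
have wts : (w - t) * (w - s) = w - t.
  by rewrite mulrBl !mulrBr ww ws tw ts; nc_ring.
have wst : (w - s) * (w - t) = w - s.
  by rewrite mulrBl !mulrBr ww wt sw st; nc_ring.
have wps : (w - p) * (w - s) = w - s.
  by rewrite mulrBl !mulrBr ww ws wp ps_; nc_ring.
have wsp : (w - s) * (w - p) = w - p.
  by rewrite mulrBl !mulrBr ww pw sw sp; nc_ring.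
rewrite p'E.
apply: (@mvn_of_algebraic _ _ (w - s) ((w - t) * (w - p))) => //.
- by rewrite -p'E.
- split; last by rewrite starB ts_ wE starD ps ps'.
  by rewrite mulrBl !mulrBr ww wt tw tt; nc_ring.
- by rewrite mulrA wst wsp.
- by rewrite -mulrA wps wts.
Qed.

(** * Refinement in V(A) *)

(** Total in [P], with default 0 off projections, so that matrices can be rewritten without
    transporting proofs. *)
Definition mx_class n (P : 'M[A]_n) : V A :=
  if @idP (is_proj P) is ReflectT PP then \pi_(V A) (ProjInfty PP) else 0.

Lemma mx_classE n (P : 'M[A]_n) (PP : is_proj P) :
  mx_class P = \pi_(V A) (ProjInfty PP).
Proof.
rewrite /mx_class; case: {-}_ / idP => // PP'.
by rewrite (bool_irrelevance PP' PP).
Qed.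

Lemma mx_class_eq n m (P : 'M[A]_n) (Q : 'M[A]_m) : is_proj P -> is_proj Q ->
  mx_class P = mx_class Q <-> mvn_equiv P Q.
Proof.
move=> PP QP; rewrite (mx_classE PP) (mx_classE QP).
by split=> [/eqmodP/asboolP|PQ]; last by apply/eqmodP/asboolP.
Qed.

Lemma mx_class_dsum n m (P : 'M[A]_n) (Q : 'M[A]_m) :
  is_proj P -> is_proj Q -> mx_class (dsum P Q) = mx_class P + mx_class Q.
Proof.
move=> PP QP; rewrite (mx_classE PP) (mx_classE QP) (mx_classE (is_proj_dsum PP QP)).
by rewrite [RHS]addV_pi; apply/eqmodP/asboolP/mvn_refl/is_proj_dsum.
Qed.

Lemma mx_class_surj (x : V A) : exists n (P : 'M[A]_n), is_proj P /\ x = mx_class P.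
Proof.
exists (psize (repr x)), (pmx (repr x)); split; first exact: pmxP.
rewrite (mx_classE (pmxP _)) -[LHS]reprK; case: (repr x) => n [P PP] /=.
by apply/eqmodP/asboolP; exact: mvn_refl.
Qed.

Definition proj_class p : V A := mx_class (p%:M : 'M_1).

Lemma adjmx_scalar p : adjmx (p%:M : 'M[A]_1) = (star p)%:M.
Proof. by apply/matrixP => i j; rewrite !ord1 !mxE. Qed.

Lemma scalar_mx1_inj : injective (fun p => p%:M : 'M[A]_1).
Proof. by move=> p q /matrixP/(_ 0 0); rewrite !mxE. Qed.

Lemma is_proj_scalar p : is_proj (p%:M : 'M[A]_1) <-> cproj p.
Proof.
split=> [/is_projP|] [].
  by rewrite adjmx_scalar -scalar_mxM => /scalar_mx1_inj ? /scalar_mx1_inj ?.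
by move=> pp ps; apply/is_projP; rewrite adjmx_scalar -scalar_mxM pp ps.
Qed.

Lemma star_mul_cproj p v : cproj p -> v * star v = p -> p * v = v.
Proof.
move=> [pp ps] vp; apply/eqP; rewrite -subr_eq0 -[X in X == 0]starK; apply/eqP.
rewrite (@star_mul_eq0 (star (p * v - v))) ?star0 // starK starB starM ps.
have -> : (p * v - v) * (star v * p - star v) =
  p * (v * star v) * p - p * (v * star v) - (v * star v) * p + v * star v by nc_ring.
by rewrite vp !pp; nc_ring.
Qed.

Lemma proj_class_equiv p q : cproj p -> cproj q -> cequiv p q ->
  proj_class p = proj_class q.
Proof.
move=> pP qP [v [vp vq]]; apply/mx_class_eq; try exact/is_proj_scalar.
apply/mvn_equivP; exists v%:M.
by rewrite /partial_isometry adjmx_scalar -!scalar_mxM vp vq star_mul_cproj.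
Qed.

Lemma proj_classD p q : cproj p -> cproj q -> p * q = 0 ->
  proj_class (p + q) = proj_class p + proj_class q.
Proof.
move=> pP qP pq0; have [[pp ps] [qq qs]] := (pP, qP).
have qp0 := cproj_comm_eq0 pP qP pq0; have pqP := cprojD pP qP pq0.
rewrite -mx_class_dsum; try exact/is_proj_scalar.
apply/mx_class_eq; [exact/is_proj_scalar| by apply: is_proj_dsum; exact/is_proj_scalar|].
apply/mvn_equivP; exists (row_mx p%:M q%:M).
have E : adjmx (row_mx p%:M q%:M : 'M_(1, 1 + 1)) = col_mx p%:M q%:M.
  by rewrite /adjmx tr_row_mx map_col_mx -!/(adjmx _) !adjmx_scalar ps qs.
rewrite /partial_isometry E mul_row_col mul_col_row -!scalar_mxM -raddfD /=.
rewrite pp qq pq0 qp0 mul_mx_row -!scalar_mxM !mulrDl pp qq pq0 qp0 addr0 add0r.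
by split=> //; rewrite /dsum !raddf0.
Qed.

Lemma mx_class_equiv_intro n m (P : 'M[A]_n) (w : 'M[A]_(m, n)) :
  is_proj P -> w *m P = w -> adjmx w *m w = P ->
  is_proj (w *m adjmx w) /\ mx_class (w *m adjmx w) = mx_class P.
Proof.
move=> PP wP ww; have wwP : is_proj (w *m adjmx w).
  by apply/is_projP; rewrite adjmxM adjmxK mulmxA -(mulmxA w) ww wP.
split=> //; apply/mx_class_eq => //; apply/mvn_equivP; exists w.
by rewrite /partial_isometry -mulmxA ww.
Qed.

(** The entries of [T] are [n] isometries with orthogonal ranges. Proper infiniteness provides two
    of them as [u], and multiplying [u] by the block sum of 1 and [T] adds one more. *)
Lemma isometric_row (hinf : properly_infinite A) n :
  exists T : 'M[A]_(1, n), adjmx T *m T = 1%:M.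
Proof.
have [u uu] : exists u : 'M[A]_(1, 1 + 1), adjmx u *m u = 1%:M.
  case: hinf => _ _ [p' [_ /mvn_equivP[w [_ w1 _]] _]].
  by exists (adjmx w); rewrite adjmxK -w1 /dsum -scalar_mx_block.
elim: n => [|n [T TT]]; first by exists 0; apply/matrixP => -[].
pose B : 'M[A]_(1 + 1, 1 + n) := block_mx 1%:M 0 0 T.
have BB : adjmx B *m B = 1%:M.
  rewrite adjmx_block !adjmx0 adjmx_scalar star1.
  rewrite mulmx_block !(mul0mx, mulmx0, addr0, add0r) TT mul1mx.
  by rewrite -scalar_mx_block.
by exists (u *m B); rewrite adjmxM mulmxA -(mulmxA _ (adjmx u)) uu mulmx1.
Qed.

Lemma proj_class_surj (hinf : properly_infinite A) (x : V A) :
  exists2 p, cproj p & x = proj_class p.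
Proof.
have [n [P [PP ->]]] := mx_class_surj x; have [T TT] := isometric_row hinf n.
have [PP' Ps] := is_projP _ PP.
have := @mx_class_equiv_intro _ _ P (T *m P) PP.
rewrite -mulmxA PP' adjmxM Ps mulmxA -(mulmxA P) TT mulmx1 PP' => -[] // qP qE.
rewrite (mx11_scalar (_ *m _)) in qP qE.
by eexists; [apply/is_proj_scalar; exact: qP | rewrite /proj_class qE].
Qed.

(** A partial isometry [w] from the block sum of [P] and [Q] to [e] is restricted to the two
    summands by [I] and [J]; the range projections of [w I] and [w J] are orthogonal with sum
    [e]. *)
Lemma proj_class_split e (x y : V A) : cproj e -> proj_class e = x + y ->
  exists p q, [/\ [/\ cproj p, cproj q, p * q = 0 & e = p + q],
    x = proj_class p & y = proj_class q].
Proof.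
move=> eP; have [n [P [PP ->]]] := mx_class_surj x; have [m [Q [QP ->]]] := mx_class_surj y.
rewrite -mx_class_dsum // => /mx_class_eq -/(_ _ _)/mvn_equivP [].
- exact/is_proj_scalar.
- exact: is_proj_dsum.
move=> w [wP we wD]; have [PP' Ps] := is_projP _ PP; have [QQ' Qs] := is_projP _ QP.
pose I := col_mx P (0 : 'M_(m, n)); pose J := col_mx (0 : 'M_(n, m)) Q.
have Is : adjmx I = row_mx P 0.
  by rewrite /adjmx tr_col_mx map_row_mx -!/(adjmx _) Ps adjmx0.
have Js : adjmx J = row_mx 0 Q.
  by rewrite /adjmx tr_col_mx map_row_mx -!/(adjmx _) Qs adjmx0.
have DI : dsum P Q *m I = I.
  by rewrite /dsum mul_block_col !mul0mx mulmx0 !addr0 PP'.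
have DJ : dsum P Q *m J = J.
  by rewrite /dsum mul_block_col !mul0mx mulmx0 !add0r QQ'.
have II : I *m adjmx I + J *m adjmx J = dsum P Q.
  rewrite Is Js !mul_col_row !(mul0mx, mulmx0) PP' QQ' add_block_mx.
  by rewrite !(addr0, add0r).
have [||pP pE] := @mx_class_equiv_intro _ _ P (w *m I) PP.
- by rewrite -mulmxA /I mul_col_mx mul0mx PP'.
- rewrite adjmxM mulmxA -(mulmxA (adjmx I)) -wD -mulmxA DI Is.
  by rewrite mul_row_col mul0mx addr0 PP'.
have [||qP qE] := @mx_class_equiv_intro _ _ Q (w *m J) QP.
- by rewrite -mulmxA /J mul_col_mx mul0mx QQ'.
- rewrite adjmxM mulmxA -(mulmxA (adjmx J)) -wD -mulmxA DJ Js.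
  by rewrite mul_row_col mul0mx add0r QQ'.
have pq0 : w *m I *m adjmx (w *m I) *m (w *m J *m adjmx (w *m J)) = 0.
  rewrite !adjmxM !mulmxA -(mulmxA _ (adjmx w) w) -wD -(mulmxA _ (dsum P Q)) DJ.
  rewrite -(mulmxA _ (adjmx I)) Is /J mul_row_col mul0mx mulmx0 addr0.
  by rewrite mulmx0 !mul0mx.
have pqe : w *m I *m adjmx (w *m I) + w *m J *m adjmx (w *m J) = e%:M.
  rewrite !adjmxM !mulmxA -mulmxDl -!(mulmxA w) -mulmxDr II.
  by rewrite wD !mulmxA wP we.
move: pP pE qP qE pq0 pqe.
set p := w *m I *m _; set q := w *m J *m _.
rewrite (mx11_scalar p) (mx11_scalar q) => /is_proj_scalar pP pE /is_proj_scalar qP qE.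
rewrite -scalar_mxM -raddfD -(raddf0 (@scalar_mx A 1)) => /scalar_mx1_inj pq0 /scalar_mx1_inj pqe.
by exists (p 0 0), (q 0 0); rewrite /proj_class pE qE.
Qed.

(** Both sums are the class of one projection [e] of [A], so they lift to two orthogonal
    decompositions of [e]. *)
Lemma V_refinement : properly_infinite A -> real_rank_zero A -> refinement (V A).
Proof.
move=> hinf rr0 a b c d abcd; have [e eP eE] := proj_class_surj hinf (a + b).
have [p [p' [[pP pP' pp' pE] -> ->]]] := proj_class_split eP (esym eE).
have [q [q' [[qP qP' qq' qE] -> ->]]] := proj_class_split eP (esym (etrans (esym abcd) eE)).
have [r [r' [[rP rP'] qr qr' E1 E2]]] :=
  projection_refinement rr0 pP pP' qP qP' pp' qq' (etrans (esym pE) qE).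
have [[qq qs] [qq2 _]] := (qP, qP').
have dP := cprojB qP rP qr; have dP' := cprojB qP' rP' qr'.
have orth (f g : A) : cproj f -> cproj g -> q * f = f -> q' * g = g -> f * g = 0.
  move=> [_ fs] [_ gs] qf q'g; have fq : f * q = f by rewrite -fs -qs -starM qf.
  by rewrite -fq -q'g mulrA -(mulrA f) qq' mulr0 mul0r.
have qd : q * (q - r) = q - r by rewrite mulrBr qq qr.
have qd' : q' * (q' - r') = q' - r' by rewrite mulrBr qq2 qr'.
have rr'0 := orth _ _ rP rP' qr qr'; have dd'0 := orth _ _ dP dP' qd qd'.
have sub_orth (f g : A) : cproj f -> cproj g -> f * g = g -> g * (f - g) = 0.
  move=> [_ fs] [gg gs] fg; rewrite mulrBr gg.
  by rewrite -{1}gs -fs -starM fg gs subrr.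
exists (proj_class r), (proj_class r'), (proj_class (q - r)), (proj_class (q' - r')).
split; rewrite -proj_classD //; try exact: sub_orth.
- by apply: proj_class_equiv => //; exact: cprojD.
- by apply: proj_class_equiv => //; exact: cprojD.
- by rewrite addrC subrK.
- by rewrite addrC subrK.
Qed.

End CStar.

(** * Weak divisibility of order units *)

Theorem corollary2p11 (R : realType) (A : cstarAlgType R)
    (hinf : properly_infinite A) (hrr0 : real_rank_zero A) :
  weak_divisibility_order_units (V A).
Proof.
move=> v [_ vu].
have le1 x : alg_le x (proj_class (1 : A)).
  have [p pP ->] := proj_class_surj hinf x; have [pp _] := pP.
  exists (proj_class (1 - p)); rewrite -proj_classD //.
  - by rewrite addrC subrK.
  - by apply: cprojB => //; [split; [exact: mulr1 | exact: star1] | exact: mul1r].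
  - by rewrite mulrBr mulr1 pp subrr.
(* Since the class of 1 is the largest element, [(n + 1) v] is below it and hence below [n v]. *)
have [n n1] := vu (proj_class 1).
apply: (@refinement_two_three _ (V_refinement hinf hrr0) _ n).
exact: alg_le_trans (le1 _) n1.
Qed.
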